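(* Let $n\in\mathbb{N}$ and let $A=\sum_{\alpha\in\mathbb{N}_0^n}\frac{c_\alpha}{\alpha!}x^\alpha\partial^\alpha$ with $c_\alpha\in\mathbb{R}$ for all $\alpha$; thus $A$ is the diagonal operator $Ax^\alpha=a_\alpha x^\alpha$ with $a_\alpha=\sum_{\beta\preceq\alpha}\binom{\alpha}{\beta}c_\beta$. For $t\ge0$ let $e^{tA}$ be the linear operator on $\mathbb{R}[x_1,\dots,x_n]$ with $e^{tA}x^\alpha=e^{ta_\alpha}x^\alpha$. The following are equivalent: (i) for every $t\ge0$, $e^{tA}$ is a positivity preserver, i.e. maps polynomials non-negative on $\mathbb{R}^n$ to polynomials non-negative on $\mathbb{R}^n$; (ii) there exist $b=(b_1,\dots,b_n)^T\in\mathbb{R}^n$, a real symmetric positive semi-definite matrix $\Sigma=(\sigma_{i,j})_{i,j=1}^n$, and a $\sigma$-finite Borel measure $\nu$ on $\mathbb{R}^n$ with $\nu(\{0\})=0$ and $\int_{\mathbb{R}^n}|x^\alpha|\,d\nu(x)<\infty$ for all $\alpha$ with $|\alpha|\ge2$, such that ($c_0\in\mathbb{R}$ arbitrary and) $c_{e_i}=b_i+\int_{\|x\|_2\ge1}x_i\,d\nu(x)$ for $i=1,\dots,n$; $c_{e_i+e_j}=\sigma_{i,j}+\int_{\mathbb{R}^n}x^{e_i+e_j}\,d\nu(x)$ for $i,j=1,\dots,n$; $c_\alpha=\int_{\mathbb{R}^n}x^\alpha\,d\nu(x)$ for all $\alpha$ with $|\alpha|\ge3$.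
   Context: Multi-index notation: $\alpha!=\prod\alpha_i!$, $x^\alpha=\prod x_i^{\alpha_i}$, $\partial^\alpha=\prod\partial_i^{\alpha_i}$, $\beta\preceq\alpha$ means $\beta_i\le\alpha_i$ for all $i$, $\binom{\alpha}{\beta}=\prod_i\binom{\alpha_i}{\beta_i}$, and $e_i$ is the $i$-th standard unit vector. *)

(* Defs.v *)
From HB Require Import structures.
From mathcomp Require Import all_boot all_order all_algebra.
From mathcomp Require Import mpoly.
From mathcomp Require Import all_classical all_reals all_analysis.

Set Implicit Arguments.
Unset Strict Implicit.
Unset Printing Implicit Defensive.

Import Order.TTheory GRing.Theory Num.Theory.
Local Open Scope ring_scope.
Local Open Scope classical_set_scope.

Definition mindex (n : nat) := mpoly.multinom n.

(* monomial x^alpha for x in R^n (R^n = n.-tuple R, with the product = Borel sigma-algebra) *)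
Definition monom {R : realType} {n : nat} (x : n.-tuple R) (al : mindex n) : R :=
  \prod_(i < n) (tnth x i) ^+ (mpoly.fun_of_multinom al i).

Definition enorm {R : realType} {n : nat} (x : n.-tuple R) : R :=
  Num.sqrt (\sum_(i < n) (tnth x i) ^+ 2).

Definition mbinom {n : nat} (al be : mindex n) : nat := (\prod_(i < n) 'C(mpoly.fun_of_multinom al i, mpoly.fun_of_multinom be i))%N.

Definition mk_mindex {n k : nat} (f : {ffun 'I_n -> 'I_k}) : mindex n :=
  mpoly.Multinom [tuple (nat_of_ord (f i)) | i < n].

(* a_alpha = sum_{beta <= alpha} binom(alpha,beta) c_beta; the beta <= alpha are enumerated as
   functions 'I_n -> 'I_(|alpha|+1) bounded by alpha (bijectively). *)
Definition eigval {R : realType} {n : nat} (c : mindex n -> R) (al : mindex n) : R :=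
  \sum_(f : {ffun 'I_n -> 'I_(mpoly.mdeg al).+1} | [forall i, (f i <= mpoly.fun_of_multinom al i)%N])
     (mbinom al (mk_mindex f))%:R * c (mk_mindex f).

Definition etA {R : realType} {n : nat} (c : mindex n -> R) (t : R)
    (p : mpoly.mpoly n R) : mpoly.mpoly n R :=
  \sum_(m <- mpoly.msupp p)
     (mpoly.mcoeff m p * expR (t * eigval c m)) *: mpoly.mpolyX R m.

Definition pos_preserver {R : realType} {n : nat}
    (T : mpoly.mpoly n R -> mpoly.mpoly n R) : Prop :=
  forall p : mpoly.mpoly n R,
    (forall v : 'I_n -> R, 0 <= mpoly.meval v p) ->
    (forall v : 'I_n -> R, 0 <= mpoly.meval v (T p)).

Definition e_ (n : nat) (i : 'I_n) : mindex n := mpoly.mnm1 i.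
Definition e2_ (n : nat) (i j : 'I_n) : mindex n := mpoly.mnm_add (mpoly.mnm1 i) (mpoly.mnm1 j).
Definition mzero (n : nat) : mindex n := mpoly.Multinom [tuple (0%N) | i < n].

(* Main.v *)
(** (ii) implies (i): the coefficients c for which e^{tA} is positivity preserving for all t >= 0 form
    a closed convex cone. It contains every c that is a positive form on the nonnegative polynomials
    (A f (v) is then the form applied to f (v (1 + x)), so A itself preserves positivity), in
    particular the moments of point masses and of nu restricted to |x|^2 >= 1/k, and it contains the
    multiples of both signs of the unit mass at 0. Drifts and squares are limits of such elements,
    Sigma is a sum of squares, and k goes to infinity.

    (i) implies (ii): differentiating at t = 0 at the point (1, ..., 1) shows that the form
    L : x^a |-> c_a is nonnegative on nonnegative polynomials vanishing at 0. Those without terms of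
    degree < 2 are viewed as functions q / |x|^2 on R^n minus 0, and L is extended to all functions
    that they dominate (M. Riesz). The extension gives a finitely additive mass; it is made countably
    additive by sampling points of [0, M[ through finer and finer finite partitions into the
    level sets of x_i and x_i x_j / |x|^2. The part of the sampled measure lying over x = 0 yields
    Sigma, the rest, divided by |x|^2, yields nu. *)
Require Import Defs.
From HB Require Import structures.
From mathcomp Require Import all_boot all_order all_algebra.
From mathcomp Require Import ssrcomplements mpoly.
From mathcomp Require Import all_classical all_reals all_analysis.
From mathcomp Require Import measurable_realfun ring lra.
Set Implicit Arguments.
Unset Strict Implicit.
Unset Printing Implicit Defensive.
Import Order.TTheory GRing.Theory Num.Theory.
Import numFieldNormedType.Exports.
Local Open Scope ring_scope.
Local Open Scope classical_set_scope.

(** Division by |x|^2 is chosen so that 1 = |x|^2 / |x|^2 lies in the domain of the form, which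
    gives the extension a finite total mass, while monomials of degree at least 2 stay dominated by
    powers of 1 + |x|^2. A positive functional on functions on R^n minus 0 may still carry mass at
    infinity or at 0. At infinity this is excluded: the domain contains |x|^2 f together with each
    monomial ratio f, so cutting off at |x|^2 < N costs O(1/N). At 0 the mass must be kept: x_i x_j
    / |x|^2 has no limit there, only limits along samples, and these form a positive semi-definite
    matrix. This is why the ratios are sampled together with the coordinates. Monomials of degree at
    least 3 carry a further coordinate factor and do not see that mass. The extended form is only
    linear, but sampled values are limits of values at genuine points and so respect products;
    relations such as |x|^2 (x_i x_j / |x|^2) = x_i x_j survive the passage to u. *)

(** * Extension of positive functionals *)

Section RieszExtension.
Context {R : realType} {T : Type}.
Implicit Types (f g h : T -> R) (G : set ((T -> R) * R)).

(** Partial functionals are encoded as sets of pairs (function, value), so that chains can simply be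
    united. Single-valuedness is a consequence: the difference of two values at f is a value at the
    zero function, which positivity forces to be nonnegative in either order. *)
Definition linear_graph G := forall k f g a b,
  G (f, a) -> G (g, b) -> G (fun x => k * f x + g x, k * a + b).

Definition positive_graph G := forall f a, G (f, a) -> (forall x, 0 <= f x) -> 0 <= a.

Definition dominated G : set (T -> R) :=
  [set f | exists g a, G (g, a) /\ forall x, `|f x| <= g x].

(** The value s given to v is the infimum of the values at majorants of v; it lies above the values
    at all minorants. Dividing f + l v >= 0 by |l| makes - f / l a minorant or a majorant of v,
    according to the sign of l. *)
Lemma graph_add_point G v : linear_graph G -> positive_graph G -> G (cst 0, 0) ->
  dominated G v -> exists s, positive_graph
    [set p | exists f a l, G (f, a) /\ p = (fun x => f x + l * v x, a + l * s)].
Proof.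
move=> linG posG G0 [w [c [Gw vw]]].
pose S := [set a | exists f, G (f, a) /\ forall x, v x <= f x].
have Sc : S c by exists w; split=> // x; apply: le_trans (ler_norm _) (vw x).
have lbS f a : G (f, a) -> (forall x, f x <= v x) -> lbound S a.
  move=> Gf fv b [g [Gg vg]].
  have := posG _ _ (linG (-1) _ _ _ _ Gf Gg).
  have H x : 0 <= -1 * f x + g x by have := fv x; have := vg x; lra.
  by move=> /(_ H); lra.
have infS : has_inf S.
  split; first by exists c.
  exists (- c); apply: (lbS (fun x => - 1 * w x + 0)).
    by have := linG (-1) _ _ _ _ Gw G0; rewrite mulN1r addr0.
  by move=> x; have := vw x; rewrite ler_norml; lra.
exists (inf S) => f a [g [b [l [Gg [-> ->]]]]] pos.
have [l0|l0|l0] := ltgtP l 0; last first.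
- rewrite l0 mul0r addr0; apply: (posG _ _ Gg) => x; have /= := pos x; rewrite l0; lra.
- have K : - l^-1 * b + 0 <= inf S.
    apply: lb_le_inf; first exact: infS.1.
    apply: (lbS (fun x => - l^-1 * g x + 0)); first exact: linG.
    move=> x; have /= := pos x; rewrite -(pmulr_rge0 (x := l^-1)) ?invr_gt0// mulrDr mulKf ?gt_eqF//.
    lra.
  rewrite addr0 mulNr -(ler_pM2l l0) mulrN mulVKf ?gt_eqF// in K; lra.
- have K : inf S <= - l^-1 * b + 0.
    apply: ge_inf; first exact: infS.2.
    exists (fun x => - l^-1 * g x + 0); split; first exact: linG.
    move=> x; have /= := pos x.
    rewrite -(pmulr_rge0 (x := - l^-1)) ?oppr_gt0 ?invr_lt0// mulrDr.
    rewrite [X in _ + X](_ : _ = - v x); last by field; rewrite lt_eqF.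
    lra.
  rewrite addr0 mulNr -(ler_nM2l l0) mulrN mulVKf ?lt_eqF// in K; lra.
Qed.

Lemma riesz_extension G0 : linear_graph G0 -> positive_graph G0 -> G0 (cst 0, 0) ->
  exists L : (T -> R) -> R, [/\
    forall k f g, dominated G0 f -> dominated G0 g -> L (fun x => k * f x + g x) = k * L f + L g,
    forall f, dominated G0 f -> (forall x, 0 <= f x) -> 0 <= L f &
    forall f a, G0 (f, a) -> L f = a].
Proof.
move=> lin0 pos0 zero0.
(* Ranging over the part A added to [G0] covers the empty chain as well: its union is empty and
   gives back [G0]. *)
pose P A := linear_graph (G0 `|` A) /\ positive_graph (G0 `|` A).
have chain (F : set (set ((T -> R) * R))) : F `<=` P -> total_on F subset -> P (\bigcup_(X in F) X).
  move=> FP totF; split.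
    have mono A B : A `<=` B -> G0 `|` A `<=` G0 `|` B by move=> AB; exact: setUS.
    move=> k f g a b [Gf|[X FX Xf]] [Gg|[Y FY Yg]].
    - by left; exact: lin0.
    - apply: (mono Y); first exact: bigcup_sup.
      by apply: (FP _ FY).1; [left|right].
    - apply: (mono X); first exact: bigcup_sup.
      by apply: (FP _ FX).1; [right|left].
    - have [XY|YX] := totF _ _ FX FY.
        apply: (mono Y); first exact: bigcup_sup.
        by apply: (FP _ FY).1; right=> //; exact: XY.
      apply: (mono X); first exact: bigcup_sup.
      by apply: (FP _ FX).1; right=> //; exact: YX.
  move=> f a [Gf|[X FX Xf]]; first exact: pos0 Gf.
  by apply: (FP _ FX).2; right.
have [A [[linA posA] maxA]] := Zorn_bigcup chain.
set G := G0 `|` A in linA posA.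
have zeroG : G (cst 0, 0) by left.
have uniqG f a b : G (f, a) -> G (f, b) -> a = b.
  move=> Ga Gb; apply/eqP; rewrite eq_le; apply/andP; split.
    have := posA _ _ (linA (-1) _ _ _ _ Ga Gb) (fun x => _).
    by rewrite mulN1r addrC subr_ge0; apply=> x; rewrite mulN1r addNr.
  have := posA _ _ (linA (-1) _ _ _ _ Gb Ga) (fun x => _).
  by rewrite mulN1r addrC subr_ge0; apply=> x; rewrite mulN1r addNr.
have totG v : dominated G0 v -> exists a, G (v, a).
  move=> Dv; apply: contrapT => nG.
  have Dv' : dominated G v by case: Dv => w [c [Gw vw]]; exists w, c; split=> //; left.
  have [s posB] := graph_add_point linA posA zeroG Dv'.
  set B := (X in positive_graph X) in posB.
  have GB : G `<=` B.
    move=> [f a] Gf; exists f, a, 0; split=> //.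
    by rewrite mul0r addr0; congr pair; apply/funext => x; rewrite mul0r addr0.
  have Bv : B (v, s).
    exists (cst 0), 0, 1; split=> //; rewrite mul1r add0r; congr pair.
    by apply/funext => x; rewrite mul1r add0r.
  apply: (maxA B).
    split.
      by apply: subset_trans GB; exact: subsetUr.
    by move=> /(_ _ Bv) => Av; apply: nG; exists s; right.
  have -> : P B = (linear_graph B /\ positive_graph B).
    by rewrite /P (_ : G0 `|` B = B)//; apply/setUidPr; apply: subset_trans GB; exact: subsetUl.
  split=> // k f g a b [f1 [a1 [l1 [G1 [-> ->]]]]] [f2 [a2 [l2 [G2 [-> ->]]]]].
  exists (fun x => k * f1 x + f2 x), (k * a1 + a2), (k * l1 + l2); split; first exact: linA.
  by congr pair; [apply/funext => x; ring|ring].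
pose L f := xget 0 [set a | G (f, a)].
have LP f : dominated G0 f -> G (f, L f).
  by move=> /totG[a Ga]; exact: (@xgetPex _ 0 [set a | G (f, a)] (ex_intro _ a Ga)).
have LE f a : G (f, a) -> L f = a.
  move=> Ga; apply: (uniqG f) => //.
  exact: (@xgetPex _ 0 [set a | G (f, a)] (ex_intro _ a Ga)).
exists L; split.
- move=> k f g Df Dg; apply: LE; apply: linA; exact: LP.
- by move=> f Df f0; exact: posA (LP _ Df) f0.
- by move=> f a Gf; apply: LE; left.
Qed.

End RieszExtension.

(** * A positive functional as an integral over sampled points *)

Section Sampling.
Context {R : realType} {X : choiceType} (x0 : X) (P : nat -> X -> bool).
Context (V : set (X -> R)) (L : (X -> R) -> R).
Hypothesis V_lin : forall k f g, V f -> V g -> V (fun x => k * f x + g x).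
Hypothesis V_solid : forall f g, V g -> (forall x, `|f x| <= `|g x|) -> V f.
Hypothesis V_one : V (cst 1).
Hypothesis L_lin : forall k f g, V f -> V g -> L (fun x => k * f x + g x) = k * L f + L g.
Hypothesis L_ge0 : forall f, V f -> (forall x, 0 <= f x) -> 0 <= L f.

Lemma V_zero : V (cst 0).
Proof. by apply: (V_solid V_one) => x /=; rewrite normr0 normr_ge0. Qed.

Lemma V_add f g : V f -> V g -> V (fun x => f x + g x).
Proof.
move=> Vf Vg; have := V_lin 1 Vf Vg; congr V.
by apply/funext => x; rewrite mul1r.
Qed.

Lemma V_scale k f : V f -> V (fun x => k * f x).
Proof.
move=> Vf; have := V_lin k Vf V_zero; congr V.
by apply/funext => x; rewrite addr0.
Qed.

Lemma L_add f g : V f -> V g -> L (fun x => f x + g x) = L f + L g.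
Proof.
move=> Vf Vg; rewrite -[L f]mul1r -L_lin//; congr L.
by apply/funext => x; rewrite mul1r.
Qed.

Lemma L_zero : L (cst 0) = 0.
Proof.
have := L_lin (-1) V_zero V_zero; rewrite (_ : (fun x => _) = cst 0); last first.
  by apply/funext => x /=; rewrite mulr0 addr0.
by move=> ->; rewrite mulN1r addNr.
Qed.

Lemma L_scale k f : V f -> L (fun x => k * f x) = k * L f.
Proof.
move=> Vf; rewrite -[RHS]addr0 -L_zero -L_lin//; last exact: V_zero.
by congr L; apply/funext => x; rewrite addr0.
Qed.

Lemma L_sub f g : V f -> V g -> L (fun x => f x - g x) = L f - L g.
Proof.
move=> Vf Vg; rewrite -[- L g]mulN1r addrC -L_lin//; congr L.
by apply/funext => x; rewrite mulN1r addrC.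
Qed.

Lemma L_le f g : V f -> V g -> (forall x, f x <= g x) -> L f <= L g.
Proof.
move=> Vf Vg fg; rewrite -subr_ge0 -L_sub//; apply: L_ge0.
  have := V_lin (-1) Vf Vg; congr V.
  by apply/funext => x; rewrite mulN1r addrC.
by move=> x; rewrite subr_ge0.
Qed.

Lemma V_bounded f B : (forall x, `|f x| <= B) -> V f.
Proof.
move=> fB; apply: (V_solid (V_scale B V_one)) => x /=; rewrite mulr1.
exact: le_trans (fB x) (ler_norm _).
Qed.

Lemma V_sum (I : Type) (r : seq I) (F : I -> X -> R) :
  (forall i, V (F i)) -> V (fun x => \sum_(i <- r) F i x).
Proof.
move=> VF; elim: r => [|i r IH].
  by under [X in V X]eq_fun do rewrite big_nil; exact: V_zero.
by under [X in V X]eq_fun do rewrite big_cons; exact: V_add.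
Qed.

Lemma L_sum (I : Type) (r : seq I) (F : I -> X -> R) :
  (forall i, V (F i)) -> L (fun x => \sum_(i <- r) F i x) = \sum_(i <- r) L (F i).
Proof.
move=> VF; elim: r => [|i r IH].
  by under [X in L X]eq_fun do rewrite big_nil; rewrite big_nil L_zero.
by under [X in L X]eq_fun do rewrite big_cons; rewrite big_cons L_add ?IH//; exact: V_sum.
Qed.

(* The answers to the first k questions, most recent first. *)
Fixpoint word k x : seq bool := if k is k'.+1 then P k' x :: word k' x else [::].

Lemma size_word k x : size (word k x) = k.
Proof. by elim: k => //= k ->. Qed.

Definition cell (w : seq bool) : set X := [set x | word (size w) x = w].

Definition mass (w : seq bool) : R := L (fun x => (word (size w) x == w)%:R).

Lemma V_bool (b : X -> bool) : V (fun x => (b x)%:R).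
Proof. by apply: (@V_bounded _ 1) => x; case: (b x); rewrite ?normr1 ?normr0. Qed.

Lemma mass_ge0 w : 0 <= mass w.
Proof. by apply: L_ge0 => [|x]; [exact: V_bool|exact: ler0n]. Qed.

Lemma mass_split w : mass w = mass (false :: w) + mass (true :: w).
Proof.
rewrite /mass -L_add; try exact: V_bool.
congr L; apply/funext => x /=; rewrite !eqseq_cons.
by case: (P _ x); rewrite /= ?addr0 ?add0r.
Qed.

Lemma mass_gt0_cell w : 0 < mass w -> exists x, cell w x.
Proof.
move=> w0; apply: contrapT => /forallNP nw; move: w0.
rewrite /mass (_ : (fun x => _) = cst 0) ?L_zero ?ltxx//.
by apply/funext => x /=; case: eqP => // /nw.
Qed.

(* Nested intervals [left_end w, left_end w + mass w[, one per word: Lebesgue measure on them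
   realizes the finitely additive mass, which makes it countably additive for free. *)
Fixpoint left_end (w : seq bool) : R :=
  if w is b :: w' then left_end w' + (if b then mass (false :: w') else 0) else 0.

(** The word of length k whose interval contains u. The interval of [false :: w] is the left part of
    that of [w], so the newest letter tells on which side of its right end u lies. *)
Fixpoint path_word k (u : R) : seq bool :=
  if k is k'.+1 then
    let w := path_word k' u in (left_end w + mass (false :: w) <= u) :: w
  else [::].

Lemma size_path_word k u : size (path_word k u) = k.
Proof. by elim: k => //= k ->. Qed.

Let I : set R := `[0, mass [::][%classic.

Lemma IE u : I u = (0 <= u < mass [::]) :> Prop.
Proof. by rewrite /I /= in_itv. Qed.

Lemma path_wordP k u : I u ->
  left_end (path_word k u) <= u < left_end (path_word k u) + mass (path_word k u).
Proof.
rewrite IE => Iu; elim: k => [|k /andP[IH1 IH2]]; first by rewrite /= add0r.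
rewrite [path_word k.+1 u]/=; set w := path_word k u in IH1 IH2 *.
rewrite (mass_split w) in IH2.
case: (leP (left_end w + mass (false :: w)) u) => H /=; apply/andP; split; lra.
Qed.

Lemma path_word_uniq w u : left_end w <= u < left_end w + mass w -> path_word (size w) u = w.
Proof.
elim: w => //= b w IH H.
have mf := mass_ge0 (false :: w); have mt := mass_ge0 (true :: w).
have -> : path_word (size w) u = w.
  by apply: IH; rewrite mass_split; case: b H => /andP[? ?]; apply/andP; split; lra.
congr cons; case: b H => /andP[H1 H2]; first by [].
by apply/negbTE; rewrite -ltNge; lra.
Qed.

Lemma left_end_bounds w : 0 <= left_end w /\ left_end w + mass w <= mass [::].
Proof.
elim: w => [|b w [IH1 IH2]]; first by rewrite /= add0r.
rewrite (mass_split w) in IH2.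
have mf := mass_ge0 (false :: w); have mt := mass_ge0 (true :: w).
by case: b => /=; split; lra.
Qed.

Lemma path_word_setE w : I `&` [set u | path_word (size w) u = w] =
  `[left_end w, left_end w + mass w[%classic.
Proof.
have [l0 lM] := left_end_bounds w.
rewrite predeqE => u; split=> [[Iu /= E]|].
  by have := path_wordP (size w) Iu; rewrite E /= in_itv.
rewrite /= in_itv /= => H; split; last exact: path_word_uniq.
by rewrite IE; case/andP: H => ? ?; apply/andP; split; lra.
Qed.

Definition rep (w : seq bool) : X := xget x0 (cell w).

Lemma word_rep w : (exists x, cell w x) -> word (size w) (rep w) = w.
Proof. by move=> [x cx]; exact: (@xgetPex _ x0 (cell w) (ex_intro _ x cx)). Qed.

Lemma word_le k m x y : (k <= m)%N -> word m x = word m y -> word k x = word k y.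
Proof.
move=> /subnK <-; elim: (m - k)%N => [//|d IH].
by rewrite addSn /= => -[_ /IH].
Qed.

(* The points of X drawn by u at depth k; f (sample k u) converges when f is continuous for the
   uniformity generated by the words. *)
Definition sample k u := rep (path_word k u).

Lemma word_sample k m u : (k <= m)%N -> I u -> word k (sample m u) = path_word k u.
Proof.
move=> /subnK <- Iu; have : word (m - k + k) (sample (m - k + k) u) = path_word (m - k + k) u.
  rewrite -{1}(size_path_word (m - k + k) u) word_rep//.
  (* A half-open interval that contains u has positive length, so the cell is inhabited and [rep] is
     a genuine element of it, not the default [x0]. *)
  apply: mass_gt0_cell; have := path_wordP (m - k + k) Iu; lra.
elim: (m - k)%N (sample _ _) => [//|d IH] x.
by rewrite addSn /= => -[_ /IH].
Qed.

Let mu := @lebesgue_measure R.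

Lemma measurable_I : measurable I. Proof. exact: measurable_itv. Qed.

Lemma measure_path_word w :
  mu (I `&` [set u | path_word (size w) u = w]) = (mass w)%:E.
Proof.
rewrite path_word_setE /mu lebesgue_measure_itv /= lte_fin.
have := mass_ge0 w; rewrite le_eqVlt => /predU1P[<-|m0].
  by rewrite addr0 ltxx.
by rewrite ltrDl m0 -EFinB addrC addKr.
Qed.

Lemma path_word_simple k (h : seq bool -> R) u :
  h (path_word k u) = \sum_(w : k.-tuple bool) h w * \1_[set v | path_word k v = w] u.
Proof.
have sz : size (path_word k u) == k by rewrite size_path_word.
rewrite (bigD1 (Tuple sz)) //= big1 ?addr0; last first.
  move=> w; rewrite indicE; case: (boolP (u \in _)); rewrite ?mulr0// inE /= => E.
  by rewrite -val_eqE /= E eqxx.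
by rewrite indicE mem_set// mulr1.
Qed.

Lemma measurable_path_word k (w : k.-tuple bool) :
  measurable [set u : R | path_word k u = w].
Proof.
case: w => w /= /eqP; elim: k w => [|k IH] [|b w] //= => [_|[sz]].
  by rewrite (_ : [set _ | _] = setT)//; apply/predeqP.
rewrite (_ : [set _ | _] = [set u | path_word k u = w] `&`
  [set u : R | (left_end w + mass (false :: w) <= u) = b]).
  apply: measurableI; first exact: IH.
  case: b.
    by rewrite (_ : [set _ | _] = `[left_end w + mass (false :: w), +oo[%classic)//;
      apply/predeqP => u /=; rewrite in_itv /= andbT.
  rewrite (_ : [set _ | _] = `]-oo, left_end w + mass (false :: w)[%classic)//.
  by apply/predeqP => u /=; rewrite in_itv /= ltNge; split=> [->|/negbTE].
by apply/predeqP => u /=; split=> [[<- ->]|[-> ->]].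
Qed.

Lemma measurable_simple k (h : seq bool -> R) D : measurable_fun D (fun u : R => h (path_word k u)).
Proof.
under [X in measurable_fun D X]eq_fun do rewrite path_word_simple.
apply: measurable_sum => w; apply: measurable_funM; first exact: measurable_cst.
by apply: measurable_indic; exact: measurable_path_word.
Qed.

Lemma mu_I_fin : (mu I < +oo)%E.
Proof. by rewrite /mu /I lebesgue_measure_itv /=; case: ifP => _; rewrite ?ltry// -EFinB ltry. Qed.

Lemma integrable_simple k (h : seq bool -> R) : mu.-integrable I (fun u => (h (path_word k u))%:E).
Proof.
pose B := \sum_(w : k.-tuple bool) `|h w|.
have mh : measurable_fun I (fun u : measurableTypeR R => h (path_word k u)).
  exact: measurable_simple.
apply: (@le_integrable _ _ _ mu I measurable_I (fun u => (h (path_word k u))%:E) (fun => B%:E)).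
- exact/measurable_EFinP.
- move=> u _; rewrite lee_fin; apply: le_trans (ler_norm _); rewrite /B.
  have sz : size (path_word k u) == k by rewrite size_path_word.
  rewrite (bigD1 (Tuple sz)) //= ler_wpDr//; exact: sumr_ge0.
- apply/integrableP; split; first exact: measurable_cst.
  by rewrite integral_cst//=; [rewrite lte_mul_pinfty// mu_I_fin|exact: measurable_I].
Qed.

(** At a fixed depth sampling is exact: both sides are the finite sum of [h w * mass w] over words
    of length k. *)
Lemma integral_simple k (h : seq bool -> R) :
  (\int[mu]_(u in I) (h (path_word k u))%:E)%E = (L (fun x => h (word k x)))%:E.
Proof.
have -> : L (fun x => h (word k x)) = \sum_(w : k.-tuple bool) h w * mass w.
  rewrite (_ : (fun x => _) = fun x => \sum_(w : k.-tuple bool) h w * (word k x == w)%:R).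
    rewrite L_sum => [|w]; last exact/V_scale/V_bool.
    apply: eq_bigr => w _; rewrite L_scale; last exact: V_bool.
    by rewrite /mass size_tuple.
  apply/funext => x.
  have sz : size (word k x) == k by rewrite size_word.
  rewrite (bigD1 (Tuple sz)) //= eqxx mulr1 big1 ?addr0// => w.
  by rewrite -val_eqE /= eq_sym => /negbTE ->; rewrite mulr0.
under eq_integral do rewrite path_word_simple -sumEFin.
have ind (w : k.-tuple bool) :
    mu.-integrable I (fun u => (\1_[set v | path_word k v = w] u)%:E).
  have := integrable_simple k (fun w' => (w' == w)%:R).
  apply: eq_integrable; first exact: measurable_I.
  move=> u _; congr EFin; rewrite indicE.
  by case: eqP => ?; [rewrite mem_set|rewrite memNset].
have mI : measurable I by exact: measurable_I.
rewrite integral_sum//=; last first.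
  by move=> w; under eq_fun do rewrite EFinM; apply: integrableZl.
rewrite -sumEFin; apply: eq_bigr => w _.
under eq_integral do rewrite EFinM.
rewrite integralZl//.
rewrite EFinM integral_indic//; [|exact: measurable_path_word].
by congr (_ * _)%E; rewrite -measure_path_word size_tuple setIC.
Qed.

(** Uniform continuity for the uniformity of words makes the values at samples Cauchy, uniformly in
    u; boundedness puts f into V and dominates its samples. *)
Definition word_continuous (f : X -> R) := (exists B, forall x, `|f x| <= B) /\
  forall e, 0 < e -> exists k, forall x y, word k x = word k y -> `|f x - f y| <= e.

Definition lift (f : X -> R) (u : R) : R := lim (f (sample n u) @[n --> \oo]).

Lemma word_continuous_V f : word_continuous f -> V f.
Proof. by move=> [[B fB] _]; exact: V_bounded fB. Qed.

Lemma word_continuous_sample f e : word_continuous f -> 0 < e ->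
  exists k, forall u n m, I u -> (k <= n)%N -> (k <= m)%N ->
    `|f (sample n u) - f (sample m u)| <= e.
Proof.
move=> [_ fu] /fu[k fk]; exists k => u n m Iu kn km; apply: fk.
by rewrite !word_sample.
Qed.

Lemma cvg_lift f u : word_continuous f -> I u ->
  f (sample n u) @[n --> \oo] --> lift f u.
Proof.
move=> fu Iu; apply: cauchy_cvg; apply: cauchy_exP => e e0.
have [k fk] := word_continuous_sample fu (divr_gt0 e0 (@ltr0n R 2)).
exists (f (sample k u)); exists k => // n /= kn.
rewrite -ball_normE /=; apply: le_lt_trans (fk _ _ _ Iu (leqnn k) kn) _; lra.
Qed.

Lemma measurable_lift f : word_continuous f -> measurable_fun I (lift f).
Proof.
move=> fu; apply: (@measurable_fun_cvg _ _ _ I (fun n u => f (sample n u))).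
  by move=> n; exact: (measurable_simple n (fun w => f (rep w))).
by move=> u Iu; exact: cvg_lift.
Qed.

Lemma integrable_cst B : mu.-integrable I (fun=> B%:E).
Proof.
apply/integrableP; split; first exact: measurable_cst.
have mI : measurable I by exact: measurable_I.
by rewrite integral_cst//= lte_mul_pinfty// mu_I_fin.
Qed.

(** For f composed with the depth n representatives the equality is exact. As n grows, the integrals
    converge by dominated convergence, and the values of L converge because the approximation of f
    is uniform and L is positive. *)
Lemma integral_lift f : word_continuous f -> (\int[mu]_(u in I) (lift f u)%:E)%E = (L f)%:E.
Proof.
move=> fu; have [[B fB] fc] := fu.
have mI : measurable I by exact: measurable_I.
have H : (\int[mu]_(x in I) (f (sample n x))%:E)%E @[n --> \oo] -->
    (\int[mu]_(u in I) (lift f u)%:E)%E.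
  apply: (@dominated_cvg _ _ _ mu I mI (fun n u => (f (sample n u))%:E)  (fun u => (lift f u)%:E) (fun=> B%:E)).
  - by move=> n; exact: measurable_int (integrable_simple n (fun w => f (rep w))).
  - by move=> u Iu; apply: cvg_EFin; [exact: nearW|exact: cvg_lift].
  - by [].
  - exact: integrable_cst.
  - by move=> n u Iu; rewrite lee_fin.
have {}H : (L (fun x => f (rep (word n x))))%:E @[n --> \oo] --> (\int[mu]_(u in I) (lift f u)%:E)%E.
  rewrite (_ : (fun n => _) = fun n => (\int[mu]_(x in I) (f (sample n x))%:E)%E)//.
  by apply/funext => n /=; rewrite -(integral_simple n (fun w => f (rep w))).
suff H2 : (L (fun x => f (rep (word n x))))%:E @[n --> \oo] --> (L f)%:E.
  exact: (cvg_unique _ H H2).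
apply: cvg_EFin; first exact: nearW.
have M0 := mass_ge0 [::].
have Vr n : V (fun x => f (rep (word n x))) by apply: V_bounded => x; exact: fB.
apply/cvgrPdist_le => e e0.
(* L of a constant is that constant times [mass [::]], the value of L at 1; adding 1 keeps the
   denominator positive when the total mass is 0. *)
have e1 : 0 < e / (mass [::] + 1) by rewrite divr_gt0// ltr_wpDl.
have [k fk] := fc _ e1; exists k => // n /= kn.
have E : L (fun=> e / (mass [::] + 1)) <= e.
  have -> : L (fun=> e / (mass [::] + 1)) = e / (mass [::] + 1) * mass [::].
    by rewrite -L_scale; [congr L; apply/funext => x /=; rewrite mulr1|exact: V_bool].
  by rewrite mulrAC ler_pdivrMr ?ltr_wpDl// ler_pM2l//; lra.
have fr x : `|f x - f (rep (word n x))| <= e / (mass [::] + 1).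
  apply: fk; apply: (word_le kn); have wx : exists y, cell (word n x) y.
    by exists x; rewrite /cell /= size_word.
  by have := word_rep wx; rewrite size_word.
have Ve : V (fun=> e / (mass [::] + 1)) by apply: V_bounded => x; exact: lexx.
have Vf := word_continuous_V fu.
rewrite ler_norml; apply/andP; split.
  rewrite lerNl opprB lerBlDl; apply: le_trans (_ : L f + L (fun=> e / (mass [::] + 1)) <= _); last lra.
  rewrite -L_add//; apply: L_le => //; first exact: V_add.
  by move=> x; have := fr x; rewrite ler_norml; lra.
rewrite lerBlDl; apply: le_trans (_ : L (fun x => f (rep (word n x))) + L (fun=> e / (mass [::] + 1)) <= _); last lra.
rewrite -L_add//; apply: L_le => //; first exact: V_add.
by move=> x; have := fr x; rewrite ler_norml; lra.
Qed.

Lemma word_continuous_lin k f g : word_continuous f -> word_continuous g ->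
  word_continuous (fun x => k * f x + g x).
Proof.
move=> [[B fB] fc] [[C gC] gc]; split.
  exists (`|k| * B + C) => x; apply: le_trans (ler_normD _ _) _.
  by rewrite normrM lerD// ler_wpM2l.
move=> e e0; have k0 : 0 < `|k| + 1 by rewrite ltr_wpDl.
have [m fm] := fc (e / 2 / (`|k| + 1)) (divr_gt0 (divr_gt0 e0 (@ltr0n R 2)) k0).
have [n gn] := gc (e / 2) (divr_gt0 e0 (@ltr0n R 2)).
exists (maxn m n) => x y xy.
have Hf := fm _ _ (word_le (leq_maxl _ _) xy).
have Hg := gn _ _ (word_le (leq_maxr _ _) xy).
rewrite (_ : _ - _ = k * (f x - f y) + (g x - g y)); last ring.
apply: le_trans (ler_normD _ _) _; rewrite normrM.
have : `|k| * `|f x - f y| <= e / 2.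
  move: Hf; rewrite ler_pdivlMr// mulrC; apply: le_trans.
  by rewrite ler_wpM2r// lerDl.
lra.
Qed.

Lemma word_continuous_mul f g : word_continuous f -> word_continuous g ->
  word_continuous (fun x => f x * g x).
Proof.
move=> [[B fB] fc] [[C gC] gc].
have B0 : 0 <= B := le_trans (normr_ge0 _) (fB x0).
have C0 : 0 <= C := le_trans (normr_ge0 _) (gC x0).
split.
  by exists (B * C) => x; rewrite normrM ler_pM.
move=> e e0.
have [m fm] := fc (e / 2 / (C + 1)) (divr_gt0 (divr_gt0 e0 (@ltr0n R 2)) (ltr_wpDl C0 ltr01)).
have [n gn] := gc (e / 2 / (B + 1)) (divr_gt0 (divr_gt0 e0 (@ltr0n R 2)) (ltr_wpDl B0 ltr01)).
exists (maxn m n) => x y xy.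
have Hf := fm _ _ (word_le (leq_maxl _ _) xy).
have Hg := gn _ _ (word_le (leq_maxr _ _) xy).
rewrite (_ : _ - _ = (f x - f y) * g x + f y * (g x - g y)); last ring.
apply: le_trans (ler_normD _ _) _; rewrite !normrM.
have : `|f x - f y| * `|g x| <= e / 2.
  move: Hf; rewrite ler_pdivlMr ?ltr_wpDl//; apply: le_trans.
  by rewrite ler_wpM2l// (le_trans (gC x))// lerDl.
have : `|f y| * `|g x - g y| <= e / 2.
  move: Hg; rewrite ler_pdivlMr ?ltr_wpDl// mulrC; apply: le_trans.
  by rewrite ler_wpM2r// (le_trans (fB y))// lerDl.
lra.
Qed.

Lemma lift_lin k f g u : word_continuous f -> word_continuous g -> I u ->
  lift (fun x => k * f x + g x) u = k * lift f u + lift g u.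
Proof.
move=> fc gc Iu; apply/cvg_lim => //.
by apply: cvgD; [apply: cvgMr|]; exact: cvg_lift.
Qed.

(** Evaluation at a sample point is multiplicative, and limits preserve this; here sampling gives
    more than the linearity of L. *)
Lemma lift_mul f g u : word_continuous f -> word_continuous g -> I u ->
  lift (fun x => f x * g x) u = lift f u * lift g u.
Proof. by move=> fc gc Iu; apply/cvg_lim => //; apply: cvgM; exact: cvg_lift. Qed.

Lemma word_continuous_norm f : word_continuous f -> word_continuous (fun x => `|f x|).
Proof.
move=> [[B fB] fc]; split; first by exists B => x; rewrite normr_id.
move=> e /fc[k fk]; exists k => x y /fk; exact: le_trans (ler_dist_dist _ _).
Qed.

Lemma lift_norm f u : word_continuous f -> I u ->
  lift (fun x => `|f x|) u = `|lift f u|.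
Proof. by move=> fc Iu; apply/cvg_lim => //; apply: cvg_norm; exact: cvg_lift. Qed.

(** * Unbounded functions, by cutting off at T < N *)

Context (T : X -> R).
Hypothesis T_ge0 : forall x, 0 <= T x.
Hypothesis T_cont : forall N : nat, word_continuous (fun x => (T x < N%:R)%R%:R).

Definition truncate (N : nat) (f : X -> R) x := f x * (T x < N%:R)%R%:R.

Definition regular (f : X -> R) := forall N, word_continuous (truncate N f).

(* Points u whose samples escape to T = +oo get the value 0. *)
Definition glift (f : X -> R) u : R := lim (lift (truncate N f) u @[N --> \oo]).

Let s N u := lift (fun x => (T x < N%:R)%R%:R) u.

Lemma truncate_le N M f : (N <= M)%N ->
  truncate N f = fun x => truncate M f x * (T x < N%:R)%R%:R.
Proof.
move=> NM; apply/funext => x; rewrite /truncate.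
case: (ltP (T x) N%:R) => [TN|_]; last by rewrite !mulr0.
by rewrite (lt_le_trans TN) ?ler_nat// !mulr1.
Qed.

Lemma lift_truncate_le N M f u : (N <= M)%N -> regular f -> I u ->
  lift (truncate N f) u = lift (truncate M f) u * s N u.
Proof. by move=> NM fr Iu; rewrite (truncate_le f NM) lift_mul. Qed.

(** The indicator is idempotent and [lift] is multiplicative. *)
Lemma lift_indicator01 N u : I u -> s N u = 0 \/ s N u = 1.
Proof.
move=> Iu; have : s N u * s N u = s N u.
  rewrite -lift_mul//; congr lift; apply/funext => x.
  by case: (_ < _); rewrite ?mulr1 ?mulr0.
have [->|s0] := eqVneq (s N u) 0; [by left|right].
by apply: (mulfI s0); rewrite mulr1.
Qed.

(** The sequence is eventually constant: if [s N u = 1], all later truncations agree with the N-th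
    one; if every [s N u] is 0, all truncations lift to 0. *)
Lemma cvg_glift f u : regular f -> I u ->
  lift (truncate N f) u @[N --> \oo] --> glift f u.
Proof.
move=> fr Iu; suff : cvg (lift (truncate N f) u @[N --> \oo]) by [].
apply/cvg_ex.
have [[N sN]|] := pselect (exists N, s N u = 1).
  exists (lift (truncate N f) u); apply: cvg_near_cst; exists N => // M /= NM.
  by rewrite (lift_truncate_le NM)// sN mulr1.
move/forallNP => sn; exists 0; apply: cvg_near_cst; apply: nearW => N.
by rewrite (lift_truncate_le (leqnn N))//; case: (lift_indicator01 N Iu) => [->|/sn//]; rewrite mulr0.
Qed.

Lemma lift_truncate N f u : regular f -> I u -> lift (truncate N f) u = glift f u * s N u.
Proof.
move=> fr Iu; have H : lift (truncate M f) u * s N u @[M --> \oo] --> glift f u * s N u.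
  by apply: cvgMl; exact: cvg_glift.
rewrite -(cvg_lim _ H)//; apply/esym/cvg_lim => //.
by apply: cvg_near_cst; exists N => // M /= NM; rewrite -lift_truncate_le.
Qed.

Lemma regular_lin k f g : regular f -> regular g -> regular (fun x => k * f x + g x).
Proof.
move=> fr gr N; have := word_continuous_lin k (fr N) (gr N).
by congr word_continuous; apply/funext => x; rewrite /truncate; ring.
Qed.

Lemma glift_lin k f g u : regular f -> regular g -> I u ->
  glift (fun x => k * f x + g x) u = k * glift f u + glift g u.
Proof.
move=> fr gr Iu; apply/cvg_lim => //.
rewrite (_ : (fun N => _) = fun N => k * lift (truncate N f) u + lift (truncate N g) u).
  by apply: cvgD; [apply: cvgMr|]; exact: cvg_glift.
apply/funext => N; rewrite -lift_lin//; congr lift.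
by apply/funext => x; rewrite /truncate; ring.
Qed.

Lemma truncate_mul N f g :
  truncate N (fun x => f x * g x) = fun x => truncate N f x * truncate N g x.
Proof.
by apply/funext => x; rewrite /truncate; case: (_ < _); rewrite ?mulr1 ?mulr0.
Qed.

Lemma regular_mul f g : regular f -> regular g -> regular (fun x => f x * g x).
Proof. by move=> fr gr N; rewrite truncate_mul; exact: word_continuous_mul. Qed.

Lemma glift_mul f g u : regular f -> regular g -> I u ->
  glift (fun x => f x * g x) u = glift f u * glift g u.
Proof.
move=> fr gr Iu; apply/cvg_lim => //.
rewrite (_ : (fun N => _) = fun N => lift (truncate N f) u * lift (truncate N g) u).
  by apply: cvgM; exact: cvg_glift.
by apply/funext => N; rewrite truncate_mul lift_mul.
Qed.

Lemma regular_cst k : regular (cst k).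
Proof.
move=> N; have := word_continuous_lin (k - 1) (T_cont N) (T_cont N).
by congr word_continuous; apply/funext => x; rewrite /truncate /=; ring.
Qed.

Lemma truncate_norm N f : truncate N (fun x => `|f x|) = fun x => `|truncate N f x|.
Proof. by apply/funext => x; rewrite /truncate normrM normr_nat. Qed.

Lemma regular_norm f : regular f -> regular (fun x => `|f x|).
Proof. by move=> fr N; rewrite truncate_norm; exact: word_continuous_norm. Qed.

Lemma glift_norm f u : regular f -> I u -> glift (fun x => `|f x|) u = `|glift f u|.
Proof.
move=> fr Iu; apply/cvg_lim => //.
rewrite (_ : (fun N => _) = fun N => `|lift (truncate N f) u|).
  by apply: cvg_norm; exact: cvg_glift.
by apply/funext => N; rewrite truncate_norm lift_norm.
Qed.

Lemma glift_ge0 f u : regular f -> I u -> (forall x, 0 <= f x) -> 0 <= glift f u.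
Proof.
move=> fr Iu f0; rewrite (_ : f = fun x => `|f x|) ?glift_norm//.
by apply/funext => x; rewrite ger0_norm.
Qed.

Lemma measurable_glift f : regular f -> measurable_fun I (glift f).
Proof.
move=> fr; apply: (@measurable_fun_cvg _ _ _ I (fun n u => lift (truncate n f) u)).
  by move=> n; exact: measurable_lift.
by move=> u Iu; exact: cvg_glift.
Qed.

(** Monotone convergence over the truncations of |f|, whose lifts have integrals at most L |f|. *)
Lemma glift_integrable f : regular f -> V f -> mu.-integrable I (fun u => (glift f u)%:E).
Proof.
move=> fr Vf; apply/integrableP; split; first by apply/measurable_EFinP; exact: measurable_glift.
have mI : measurable I by exact: measurable_I.
have H : (\int[mu]_(u in I) (lift (truncate N (fun x => `|f x|)) u)%:E)%E @[N --> \oo] -->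
    (\int[mu]_(u in I) `|(glift f u)%:E|)%E.
  have -> : (\int[mu]_(u in I) `|(glift f u)%:E|)%E =
     (\int[mu]_(u in I) limn (fun N => (lift (truncate N (fun x => `|f x|)) u)%:E))%E.
    apply: eq_integral => u /[!inE] Iu; apply/esym/cvg_lim => //.
    rewrite abse_EFin -glift_norm//; apply: cvg_EFin; first exact: nearW.
    by apply: cvg_glift => //; exact: (regular_norm fr).
  apply: cvg_monotone_convergence => //.
  - by move=> n; apply/measurable_EFinP; apply: measurable_lift; exact: (regular_norm fr).
  - by move=> n u Iu; rewrite lee_fin truncate_norm lift_norm.
  - move=> u Iu n m nm; rewrite lee_fin !truncate_norm !lift_norm//.
    rewrite (lift_truncate_le nm)// normrM.
    by case: (lift_indicator01 n Iu) => ->; rewrite ?normr0 ?normr1 ?mulr0 ?mulr1.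
have V1 N : V (truncate N (fun x => `|f x|)).
  by apply: word_continuous_V; exact: (regular_norm fr).
apply: (@le_lt_trans _ _ (L (fun x => `|f x|))%:E); last exact: ltry.
rewrite -(cvg_lim _ H)//; apply: lime_le; first by apply/cvg_ex; eexists; exact: H.
apply: nearW => N; rewrite integral_lift ?lee_fin; last exact: (regular_norm fr).
apply: L_le; [exact: V1|by apply: (V_solid Vf) => x; rewrite normr_id|move=> x].
by rewrite /truncate; case: (_ < _); rewrite ?mulr1 ?mulr0.
Qed.

(** A Markov inequality: where T >= N, |f| <= |T f| / N, so truncation changes the value of L by at
    most L |T f| / N. Membership of T f in V is what keeps mass from escaping to infinity. *)
Lemma integral_glift f : regular f -> V f -> V (fun x => T x * f x) ->
  (\int[mu]_(u in I) (glift f u)%:E)%E = (L f)%:E.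
Proof.
move=> fr Vf VTf; have mI : measurable I by exact: measurable_I.
have H1 : (\int[mu]_(u in I) (lift (truncate N f) u)%:E)%E @[N --> \oo] -->
    (\int[mu]_(u in I) (glift f u)%:E)%E.
  apply: (@dominated_cvg _ _ _ mu I mI (fun n u => (lift (truncate n f) u)%:E)
    (fun u => (glift f u)%:E) (fun u => `|(glift f u)%:E|%E)) => //.
  - by move=> n; apply/measurable_EFinP; apply: measurable_lift; exact: fr.
  - by move=> u Iu; apply: cvg_EFin; [exact: nearW|exact: cvg_glift].
  - by apply: integrable_abse => //; exact: glift_integrable.
  - move=> n u Iu; rewrite !abse_EFin lee_fin lift_truncate// normrM.
    by case: (lift_indicator01 n Iu) => ->; rewrite ?normr0 ?normr1 ?mulr0 ?mulr1.
have H2 : (L (truncate N f))%:E @[N --> \oo] --> (L f)%:E.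
  apply: cvg_EFin; first exact: nearW.
  pose C := L (fun x => `|T x * f x|).
  have VC : V (fun x => `|T x * f x|) by apply: (V_solid VTf) => x; rewrite normr_id.
  have C0 : 0 <= C by exact: L_ge0.
  apply/cvgrPdist_le => e e0.
  have [k kC] : exists k : nat, C < k%:R * e.
    exists (Num.bound (C / e)); rewrite -ltr_pdivrMr//; apply: archi_boundP.
    by rewrite divr_ge0// ltW.
  exists k.+1 => // N /= kN.
  have N0 : 0 < N%:R :> R by rewrite ltr0n (leq_trans _ kN).
  have Vt : V (truncate N f) by exact: word_continuous_V.
  rewrite -L_sub//.
  have D x : `|f x - truncate N f x| <= N%:R^-1 * `|T x * f x|.
    rewrite /truncate; case: (ltP (T x) N%:R) => TN.
      by rewrite mulr1 subrr normr0 mulr_ge0// invr_ge0 ltW.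
    by rewrite mulr0 subr0 normrM (ger0_norm (T_ge0 _)) mulrA ler_peMl// mulrC ler_pdivlMr// mul1r.
  have VD : V (fun x => f x - truncate N f x).
    by apply: (V_solid (V_scale N%:R^-1 VC)) => x; exact: le_trans (D x) (ler_norm _).
  have Ce : N%:R^-1 * C <= e.
    rewrite mulrC ler_pdivrMr// mulrC; apply: le_trans (ltW kC) _.
    by apply: ler_wpM2r; [exact: ltW|rewrite ler_nat ltnW].
  have V' := V_scale N%:R^-1 VC.
  rewrite ler_norml; apply/andP; split.
    rewrite lerNl; apply: le_trans Ce; rewrite -L_scale// -mulN1r -L_scale//.
    apply: L_le => // [|x]; first exact: V_scale.
    by have := D x; rewrite ler_norml; lra.
  apply: le_trans Ce; rewrite -L_scale//; apply: L_le => // x.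
  exact: le_trans (ler_norm _) (D x).
apply: (cvg_unique _ H1) => //.
rewrite (_ : (fun N => _) = fun N => (L (truncate N f))%:E)//.
by apply/funext => N; exact: integral_lift.
Qed.

End Sampling.

(** The interface of the construction: for each u, [G ^~ u] is linear, multiplicative and positive
    on regular functions, and L is the integral of these characters. They need not send 1 to 1: at a
    u whose samples escape, the value at 1 is 0. *)
Lemma exists_sampling {R : realType} {X : choiceType} (x0 : X) (P : nat -> X -> bool)
    (V : set (X -> R)) (L : (X -> R) -> R) (T : X -> R) :
  (forall k f g, V f -> V g -> V (fun x => k * f x + g x)) ->
  (forall f g, V g -> (forall x, `|f x| <= `|g x|) -> V f) ->
  V (cst 1) ->
  (forall k f g, V f -> V g -> L (fun x => k * f x + g x) = k * L f + L g) ->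
  (forall f, V f -> (forall x, 0 <= f x) -> 0 <= L f) ->
  (forall x, 0 <= T x) ->
  (forall N : nat, word_continuous P (fun x => (T x < N%:R)%R%:R : R)) ->
  exists (M : R) (G : (X -> R) -> R -> R),
  [/\ forall k f g u, regular P T f -> regular P T g -> `[0, M[%classic u ->
        G (fun x => k * f x + g x) u = k * G f u + G g u,
      forall f g u, regular P T f -> regular P T g -> `[0, M[%classic u ->
        G (fun x => f x * g x) u = G f u * G g u &
      forall f u, regular P T f -> `[0, M[%classic u -> (forall x, 0 <= f x) -> 0 <= G f u] /\
  [/\ forall f, regular P T f -> measurable_fun `[0, M[ (G f),
      forall f, regular P T f -> V f -> (@lebesgue_measure R).-integrable `[0, M[ (EFin \o G f) &
      forall f, regular P T f -> V f -> V (fun x => T x * f x) ->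
        (\int[@lebesgue_measure R]_(u in `[0%R, M[) (G f u)%:E = (L f)%:E)%E].
Proof.
move=> V_lin V_solid V_one L_lin L_ge0 T_ge0 T_cont.
exists (mass P L [::]), (glift x0 P L T); split; split.
- exact: (glift_lin x0 V_lin V_solid V_one L_lin T_cont).
- exact: (glift_mul x0 V_lin V_solid V_one L_lin T_cont).
- exact: (glift_ge0 x0 V_lin V_solid V_one L_lin T_cont).
- exact: (measurable_glift x0 V_lin V_solid V_one L_lin T_cont).
- exact: (glift_integrable x0 V_lin V_solid V_one L_lin L_ge0 T_cont).
- exact: (integral_glift x0 V_lin V_solid V_one L_lin L_ge0 T_ge0 T_cont).
Qed.

(** * Rational threshold questions for countably many functions *)

Section Thresholds.
Context {R : realType} {X : choiceType} {K : countType} (g : K -> X -> R).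

Definition threshold (k : nat) (x : X) : bool :=
  if unpickle k is Some (i, q) then g i x < ratr (q : rat) else false.

Lemma thresholdE i q x : threshold (pickle (i, q)) x = (g i x < ratr q).
Proof. by rewrite /threshold pickleK. Qed.

Lemma word_nth (P : nat -> X -> bool) k i x y : (i < k)%N -> word P k x = word P k y -> P i x = P i y.
Proof.
elim: k => // k IH; rewrite ltnS leq_eqVlt => /predU1P[->|ik] /= [Pk wk] //.
exact: IH.
Qed.

Lemma word_threshold i q k x y : (pickle (i, q) < k)%N ->
  word threshold k x = word threshold k y -> (g i x < ratr q) = (g i y < ratr q).
Proof. by move=> ik /(word_nth ik); rewrite !thresholdE. Qed.

Lemma threshold_continuous i q :
  word_continuous threshold (fun x => (g i x < ratr q)%R%:R : R).
Proof.
split; first by exists 1 => x; case: (_ < _); rewrite ?normr1 ?normr0.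
move=> e e0; exists (pickle (i, q)).+1 => x y /word_threshold ->//.
by rewrite subrr normr0 ltW.
Qed.

Lemma threshold_continuous_nat i (N : nat) :
  word_continuous threshold (fun x => (g i x < N%:R)%R%:R : R).
Proof. by have := threshold_continuous i N%:R; rewrite ratr_nat. Qed.

Lemma regular_coordinate i iT :
  (forall N : nat, exists B : nat, forall x, g iT x < N%:R -> `|g i x| <= B%:R) ->
  regular threshold (g iT) (g i).
Proof.
move=> bnd N; have [B gB] := bnd N; split.
  exists B%:R => x; rewrite /truncate; case: (ltP _ _) => xN.
    by rewrite mulr1 gB.
  by rewrite mulr0 normr0.
move=> e e0.
pose d := Num.bound e^-1.
have de : d.+1%:R^-1 <= e.
  rewrite invf_ple ?posrE// ltW//; apply: lt_trans (archi_boundP _) _; first by rewrite invr_ge0 ltW.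
  by rewrite ltr_nat.
pose q (j : nat) : rat := j%:R / d.+1%:R - B%:R.
have qE j : ratr (q j) = j%:R / d.+1%:R - B%:R :> R.
  by rewrite /q rmorphB /= fmorph_div /= !ratr_nat.
(* A value up to B falls into a grid interval of index j at most 2 B (d + 1); its right end has
   index j + 1, which must be below J too. *)
pose J := ((B + B) * d.+1).+2.
pose k1 := \max_(j < J) pickle (i, q j).
pose k2 := pickle (iT, N%:R : rat).
exists (k1 + k2).+1 => x y xy.
have TE : (g iT x < N%:R) = (g iT y < N%:R).
  have := @word_threshold iT N%:R _ x y _ xy; rewrite ratr_nat; apply.
  by rewrite ltnS leq_addl.
have gE j : (j < J)%N -> (g i x < ratr (q j)) = (g i y < ratr (q j)).
  move=> jJ; apply: (word_threshold _ xy); rewrite ltnS; apply: leq_trans (leq_addr _ _).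
  exact: (@leq_bigmax _ (fun j : 'I_J => pickle (i, q j)) (Ordinal jJ)).
rewrite /truncate -TE; case: (ltP (g iT x) N%:R) => xN; last first.
  by rewrite !mulr0 subrr normr0 ltW.
rewrite !mulr1; have xB := gB _ xN.
have d0 : 0 < d.+1%:R :> R by rewrite ltr0n.
have xB0 : 0 <= (g i x + B%:R) * d.+1%:R.
  by rewrite mulr_ge0//; move: xB; rewrite ler_norml; lra.
have := truncn_itv xB0; set j := Num.truncn _ => /andP[j1 j2].
have jJ : (j.+1 < J)%N.
  rewrite /J !ltnS -(ler_nat R) (le_trans j1)// natrM ler_pM2r// natrD lerD2r.
  by apply: le_trans xB; exact: ler_norm.
have := gE j.+1 jJ; have := gE j (ltnW jJ); rewrite !qE.
have x1 : j%:R / d.+1%:R - B%:R <= g i x by rewrite lerBlDr ler_pdivrMr.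
have x2 : g i x < j.+1%:R / d.+1%:R - B%:R by rewrite ltrBrDr ltr_pdivlMr.
rewrite x2 (ltNge (g i x)) x1 /= => /esym/negbT; rewrite -leNgt => y1 y2'.
have y2 : g i y < j.+1%:R / d.+1%:R - B%:R by rewrite -y2'.
have E : j.+1%:R / d.+1%:R = j%:R / d.+1%:R + d.+1%:R^-1 :> R by rewrite -natr1 mulrDl mul1r.
move: de x1 x2 y1 y2; rewrite E.
move: {E} (j%:R / d.+1%:R : R) => a; move: (d.+1%:R^-1 : R) => b; rewrite ler_norml => *; apply/andP; split; lra.
Qed.

End Thresholds.

(** * Integration against the image of a measure with density *)

Section WeightedPushforward.
Context {d d' : measure_display} {X : measurableType d} {Y : measurableType d'} {R : realType}.
Context (mu : {measure set X -> \bar R}) (W : X -> R) (phi : X -> Y).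
Hypothesis mW : measurable_fun [set: X] W.
Hypothesis W_ge0 : forall x, 0 <= W x.
Hypothesis mphi : measurable_fun [set: X] phi.

(** The proofs are arguments of the term so that the measure structure declared below can be
    inferred from it. *)
Definition weighted_pushforward of measurable_fun [set: X] W & (forall x, 0 <= W x) &
  measurable_fun [set: X] phi := fun A : set Y =>
  (\int[mu]_(x in phi @^-1` A) (W x)%:E)%E.

Local Notation nu := (weighted_pushforward mW W_ge0 mphi).

Let measurable_preimage A : measurable A -> measurable (phi @^-1` A).
Proof. by move=> mA; rewrite -[phi @^-1` A]setTI; exact: mphi. Qed.

Let nu0 : nu set0 = 0%E.
Proof. by rewrite /weighted_pushforward preimage_set0 integral_set0. Qed.

Let nu_ge0 A : (0 <= nu A)%E.
Proof. by apply: integral_ge0 => x _; rewrite lee_fin. Qed.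

Let nu_sigma_additive : semi_sigma_additive nu.
Proof.
move=> F mF tF mUF; rewrite /weighted_pushforward preimage_bigcup.
apply: cvg_toP.
  apply: ereal_nondecreasing_is_cvgn => m n mn.
  by apply: lee_sum_nneg_natr => // k _ _; apply: integral_ge0 => x _; rewrite lee_fin.
rewrite ge0_integral_bigcup//=.
- by move=> k; exact: measurable_preimage.
- by apply/measurable_EFinP; exact: measurable_funTS.
- by move=> x _; rewrite lee_fin.
- apply/trivIsetP => i j _ _ ij; rewrite -preimage_setI.
  by move/trivIsetP : tF => /(_ i j I I ij) ->; rewrite preimage_set0.
Qed.

HB.instance Definition _ := isMeasure.Build _ _ _ nu nu0 nu_ge0 nu_sigma_additive.

Import HBNNSimple.

Let integral_nnsfun_weighted (h : {nnsfun Y >-> R}) :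
  (\int[nu]_y (h y)%:E = \int[mu]_x ((h (phi x))%:E * (W x)%:E))%E.
Proof.
rewrite integralT_nnsfun sintegralE.
under [RHS]eq_integral => x _.
  rewrite fimfunE -fsumEFin// ge0_mule_fsuml; last by move=> y; exact: nnfun_muleindic_ge0.
  over.
have mind (r : R) : measurable_fun setT (fun x => (r * \1_(h @^-1` [set r]) (phi x))%:E).
  apply/measurable_EFinP/measurable_funM; first exact: measurable_cst.
  have mr : measurable_fun setT (\1_(h @^-1` [set r]) : Y -> R) by exact: measurable_indic.
  exact: (measurableT_comp mr mphi).
have mWe : measurable_fun setT (EFin \o W) by exact/measurable_EFinP.
rewrite ge0_integral_fsum//; last 2 first.
- by move=> r; exact: emeasurable_funM.
- move=> r x _; apply: mule_ge0; last by rewrite lee_fin.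
  exact: nnfun_muleindic_ge0.
apply: eq_fsbigr => r /[!inE] -[y _ <-].
under eq_integral do rewrite EFinM -muleA.
have mind' : measurable_fun setT (EFin \o (\1_(h @^-1` [set h y]) \o phi) : X -> \bar R).
  apply/measurable_EFinP.
  have mr : measurable_fun setT (\1_(h @^-1` [set h y]) : Y -> R) by exact: measurable_indic.
  exact: (measurableT_comp mr mphi).
rewrite ge0_integralZl//; last 3 first.
- exact: emeasurable_funM.
- by move=> x _; rewrite mule_ge0// lee_fin.
- by rewrite lee_fin.
congr (_ * _)%E.
rewrite /= /weighted_pushforward [LHS]integral_mkcond; apply: eq_integral => x _.
rewrite patchE /= indicE; case: ifPn => xh.
  by rewrite mem_set ?mul1e//; move: xh; rewrite inE.
by rewrite memNset ?mul0e//; move: xh; rewrite notin_setE.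
Qed.

Lemma ge0_integral_weighted (f : Y -> \bar R) : measurable_fun setT f ->
  (forall y, 0 <= f y)%E ->
  (\int[nu]_y f y = \int[mu]_x (f (phi x) * (W x)%:E))%E.
Proof.
move=> mf f0; pose h := nnsfun_approx measurableT mf.
have fE y : f y = limn (EFin \o h ^~ y).
  by apply/esym/cvg_lim => //; apply: cvg_nnsfun_approx.
have mWe : measurable_fun setT (EFin \o W) by exact/measurable_EFinP.
transitivity (limn (fun n => \int[nu]_y (h n y)%:E))%E.
  rewrite -monotone_convergence//.
  - by apply: eq_integral => y _; rewrite fE.
  - by move=> n; exact/measurable_EFinP/measurable_funP.
  - by move=> n y _; rewrite lee_fin.
  - by move=> y _ m n mn; rewrite lee_fin; exact/lefP/nd_nnsfun_approx.
transitivity (limn (fun n => \int[mu]_x ((h n (phi x))%:E * (W x)%:E)))%E.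
  by congr (limn _); apply/funext => n; rewrite integral_nnsfun_weighted.
rewrite -monotone_convergence//.
- apply: eq_integral => x _; apply/cvg_lim => //.
  by apply: cvgeZr => //; exact: cvg_nnsfun_approx.
- move=> n; apply: emeasurable_funM => //; apply/measurable_EFinP.
  by apply: measurableT_comp => //; exact/measurable_funP.
- by move=> n x _; rewrite mule_ge0// lee_fin.
- move=> x _ m n mn; rewrite lee_wpmul2r ?lee_fin//; exact/lefP/nd_nnsfun_approx.
Qed.

(** Both integrals are differences of integrals of positive and negative parts, and multiplication
    by W >= 0 commutes with taking these parts. *)
Lemma integral_weighted (f : Y -> R) : measurable_fun setT f ->
  (\int[nu]_y (f y)%:E = \int[mu]_x (f (phi x) * W x)%:E)%E.
Proof.
move=> mf; have mfe : measurable_fun setT (EFin \o f) by exact/measurable_EFinP.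
rewrite [LHS]integralE [RHS]integralE; congr (_ - _)%E.
  rewrite ge0_integral_weighted//; last exact: measurable_funepos.
  apply: eq_integral => x _; rewrite !funeposE -EFin_max -EFinM -EFin_max.
  by congr EFin; rewrite maxr_pMl// mul0r.
rewrite ge0_integral_weighted//; last exact: measurable_funeneg.
apply: eq_integral => x _; rewrite !funenegE -!EFinN -EFin_max -EFinM -EFin_max.
by congr EFin; rewrite maxr_pMl// mul0r mulNr.
Qed.

End WeightedPushforward.

(** The upper bound inverts exp(-x) >= 1 - x: the product (1 + x + 2 x^2) (1 - x) = 1 + x^2 (1 - 2
    x) is at least 1 exactly when x <= 1/2 or x = 0. *)
Lemma expR_quadratic (R : realType) (x : R) : `|x| <= 2^-1 -> `|expR x - 1 - x| <= 2 * x ^+ 2.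
Proof.
rewrite !ler_norml => /andP[x1 x2].
have lo := expR_ge1Dx x; have := expR_ge1Dx (- x) => lo'.
have hi : expR x <= 1 + x + 2 * x ^+ 2.
  have -> : expR x = (expR (- x))^-1 by rewrite expRN invrK.
  rewrite -[leRHS]invrK lef_pV2 ?posrE ?expR_gt0//; last by rewrite invr_gt0; nra.
  apply: le_trans lo'; rewrite invf_ple ?posrE; [|nra|nra].
  rewrite -[leLHS]mul1r ler_pdivrMr; nra.
by apply/andP; split; nra.
Qed.

(** * The form x^m |-> c_m and the derivative of the semigroup *)

Section CoefficientFunctional.
Context {R : realType} {n : nat}.
Implicit Types (s c : mindex n -> R) (p q : {mpoly R[n]}) (al m : mindex n).

Definition coef_form s p : R := \sum_(m <- msupp p) p@_m * s m.

Lemma coef_form_widen s p k : (msize p <= k)%N ->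
  coef_form s p = \sum_(m : 'X_{1..n < k}) p@_m * s m.
Proof.
move=> le_pk; pose I : subFinType _ := 'X_{1..n < k}.
rewrite /coef_form (big_mksub I) //=; first last.
  by move=> x /msize_mdeg_lt /leq_trans; apply.
  by rewrite msupp_uniq.
by rewrite big_rmcond //= => i; move/memN_msupp_eq0 ->; rewrite mul0r.
Qed.

Lemma coef_form_is_linear s : linear_for *%R (coef_form s).
Proof.
move=> k p q.
pose w := maxn (msize (k *: p + q)) (maxn (msize p) (msize q)).
rewrite (@coef_form_widen s (k *: p + q) w) ?leq_maxl//.
rewrite (@coef_form_widen s p w) ?leq_max ?leqnn ?orbT//.
rewrite (@coef_form_widen s q w) ?leq_max ?leqnn ?orbT//.
rewrite mulr_sumr -big_split /=; apply: eq_bigr => m _.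
by rewrite mcoeffD mcoeffZ mulrDl mulrA.
Qed.

HB.instance Definition _ s := GRing.isLinear.Build R {mpoly R[n]} R *%R
  (coef_form s) (coef_form_is_linear s).

Lemma coef_formX s m : coef_form s 'X_[m] = s m.
Proof. by rewrite /coef_form msuppX big_seq1 mcoeffX eqxx mul1r. Qed.

Definition shift_tuple (e : R) : n.-tuple {mpoly R[n]} := [tuple 'X_i + e%:MP | i < n].

Lemma shift_tupleK e p : (p \mPo shift_tuple (- e)) \mPo shift_tuple e = p.
Proof.
rewrite (comp_mpolyEX p) raddf_sum [RHS]mpolyE /=; apply: eq_bigr => m _.
rewrite comp_mpolyZ; congr (_ *: _).
rewrite comp_mpolyX rmorph_prod mpolyXE_id; apply: eq_bigr => i _ /=.
rewrite rmorphXn; congr (_ ^+ _).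
rewrite tnth_mktuple /= comp_mpolyD comp_mpolyC comp_mpolyXU.
by rewrite -tnth_nth tnth_mktuple mpolyCN addrK.
Qed.

Lemma prod_mpolyX (f : 'I_n -> nat) al : (forall i, al i = f i) ->
  \prod_i 'X_i ^+ f i = 'X_[al] :> {mpoly R[n]}.
Proof. by move=> E; rewrite mpolyXE_id; apply: eq_bigr => i _; rewrite E. Qed.

(** The binomial expansion of (1 + x)^al: the eigenvalue a_al is the form applied to this
    polynomial. Each factor is expanded up to exponent |al|, matching the index type in [eigval];
    the exponents not below al have a vanishing binomial coefficient. *)
Lemma coef_form_shiftX c al : coef_form c ('X_[al] \mPo shift_tuple 1) = eigval c al.
Proof.
rewrite comp_mpolyX.
have E (i : 'I_n) : tnth (shift_tuple 1) i ^+ al i =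
    \sum_(j < (mdeg al).+1) ('X_i ^+ j : {mpoly R[n]}) *+ 'C(al i, j).
  rewrite tnth_mktuple addrC exprDn.
  have le_i : ((al i).+1 <= (mdeg al).+1)%N.
    by rewrite ltnS mdegE (bigD1 i)//= leq_addr.
  rewrite (big_ord_widen _ (fun j => (1%:MP ^+ (al i - j) * 'X_i ^+ j : {mpoly R[n]}) *+ 'C(al i, j)) le_i).
  rewrite big_mkcond; apply: eq_bigr => j _; rewrite mpolyC1 expr1n mul1r ltnS.
  by case: leqP => // /bin_small ->; rewrite mulr0n.
under eq_bigr do rewrite E.
rewrite bigA_distr_bigA /= raddf_sum /eigval [RHS]big_mkcond /=; apply: eq_bigr => f _.
have -> : \prod_i (('X_i ^+ f i : {mpoly R[n]}) *+ 'C(al i, f i)) =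
    (mbinom al (mk_mindex f))%:R *: 'X_[mk_mindex f].
  have mkE i : mk_mindex f i = f i by rewrite multinomE tnth_mktuple.
  rewrite -(@prod_mpolyX (fun i => f i)) => [|i]; last by rewrite mkE.
  rewrite scaler_nat prodrMn; congr (_ *+ _); rewrite /mbinom.
  by apply: eq_bigr => i _; rewrite mkE.
rewrite linearZ /= coef_formX; case: ifPn => // /forallPn[i]; rewrite -ltnNge => ai.
rewrite [mbinom _ _](_ : _ = 0%N) ?mul0r//.
by rewrite /mbinom (bigD1 i)//= multinomE tnth_mktuple bin_small// mul0n.
Qed.

Lemma coef_form_eigval c p : coef_form (eigval c) p = coef_form c (p \mPo shift_tuple 1).
Proof.
rewrite comp_mpolyEX raddf_sum /= {1}/coef_form; apply: eq_bigr => m _.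
by rewrite linearZ /= coef_form_shiftX.
Qed.

Lemma meval_one_etA c t p : meval (fun=> 1) (etA c t p) =
  coef_form (fun m => expR (t * eigval c m)) p.
Proof.
rewrite /etA raddf_sum /=; apply: eq_bigr => m _.
by rewrite mevalZ mevalX big1 ?mulr1// => i _; rewrite expr1n.
Qed.

(* The derivative at t = 0 of the semigroup, tested at the point (1, ..., 1), is nonnegative on
   nonnegative polynomials vanishing there. *)
Lemma coef_form_eigval_ge0 c p : (forall t, 0 <= t -> pos_preserver (etA c t)) ->
  (forall v, 0 <= meval v p) -> meval (fun=> 1) p = 0 -> 0 <= coef_form (eigval c) p.
Proof.
move=> cpos p0 p1.
pose f t := coef_form (fun m => expR (t * eigval c m)) p.
have f0 : \sum_(m <- msupp p) p@_m = 0.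
  rewrite -[RHS]p1 mevalE; apply: eq_bigr => m _.
  by rewrite big1 ?mulr1// => i _; rewrite expr1n.
pose a := eigval c.
pose K := \sum_(m <- msupp p) `|p@_m| * a m ^+ 2.
pose A := \sum_(m <- msupp p) `|a m|.
have K0 : 0 <= K by apply: sumr_ge0 => m _; rewrite mulr_ge0// sqr_ge0.
have A0 : 0 <= A by exact: sumr_ge0.
have fle t : 0 <= t -> t * (A + 1) <= 2^-1 -> f t <= t * coef_form a p + 2 * t ^+ 2 * K.
  (* Subtracting p(1, ..., 1) = 0 turns each exp(t a_m) into exp(t a_m) - 1, so that the quadratic
     estimate applies term by term. *)
  move=> t0 tA; rewrite -[leLHS]subr0 -f0 /f /coef_form -sumrB !mulr_sumr -big_split /=.
  rewrite !big_seq; apply: ler_sum => m mp.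
  have ta : `|t * a m| <= 2^-1.
    rewrite normrM (ger0_norm t0); apply: le_trans tA; rewrite ler_wpM2l//.
    have S : 0 <= \sum_(y <- rem m (msupp p)) `|a y| by exact: sumr_ge0.
    by rewrite /A (big_rem m)//=; lra.
  have := expR_quadratic ta; have : p@_m <= `|p@_m| := ler_norm _.
  have : - p@_m <= `|p@_m| by rewrite -normrN; exact: ler_norm.
  set y := expR _; rewrite -/(a m) ler_norml => pl pr /andP[y1 y2]. nra.
apply/ler_addgt0Pr => e e0.
(* The first bound makes every |t a_m| at most 1/2; the second makes the error 2 t^2 K at most t e,
   so that dividing by t leaves e. *)
pose t := Num.min (2^-1 / (A + 1)) (e / (2 * K + 1)).
have t0 : 0 < t.
  rewrite lt_min !divr_gt0//; lra.
have tA : t * (A + 1) <= 2^-1.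
  by rewrite -ler_pdivlMr ?ltr_wpDl// ge_min lexx.
have tK : t * (2 * K + 1) <= e.
  by rewrite -ler_pdivlMr ?ge_min ?lexx ?orbT//; lra.
have ft : 0 <= f t by rewrite /f -meval_one_etA; apply: cpos => //; exact: ltW.
have := fle t (ltW t0) tA; rewrite -/a => ft'.
have : 0 <= t * (coef_form a p + e) by nra.
by rewrite pmulr_rge0.
Qed.

(* Substitute q(x - 1) in the previous lemma. *)
Lemma coef_form_ge0 c q : (forall t, 0 <= t -> pos_preserver (etA c t)) ->
  (forall v, 0 <= meval v q) -> meval (fun=> 0) q = 0 -> 0 <= coef_form c q.
Proof.
move=> cpos q0 q1; rewrite -(shift_tupleK 1 q) -coef_form_eigval.
have E v : meval v (q \mPo shift_tuple (- 1)) = meval (fun i => v i - 1) q.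
  rewrite comp_mpoly_meval; apply: meval_eq => i.
  by rewrite tnth_mktuple mevalD mevalXU mevalC.
apply: coef_form_eigval_ge0 => // [v|]; rewrite E//.
by rewrite -[RHS]q1; apply: meval_eq => i; rewrite subrr.
Qed.

End CoefficientFunctional.

(** * Estimates for monomials, and polynomials without terms of degree < 2 *)

Section Monomials.
Context {R : realType} {n : nat}.
Implicit Types (x : n.-tuple R) (al ga : mindex n).

Lemma monomD x al ga : monom x (al + ga)%MM = monom x al * monom x ga.
Proof. by rewrite /monom -big_split /=; apply: eq_bigr => i _; rewrite mnmDE exprD. Qed.

Lemma monomU x i : monom x U_(i)%MM = tnth x i.
Proof.
rewrite /monom (bigD1 i)//= mnm1E eqxx expr1 big1 ?mulr1// => j ji.
by rewrite mnm1E eq_sym (negbTE ji) expr0.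
Qed.

Lemma monomE x al : monom x al = meval (tnth x) 'X_[al].
Proof. by rewrite mevalX. Qed.

Definition sqnorm x : R := \sum_i tnth x i ^+ 2.

Lemma sqnorm_ge0 x : 0 <= sqnorm x.
Proof. by apply: sumr_ge0 => i _; exact: sqr_ge0. Qed.

Lemma sqr_tnth_le x i : tnth x i ^+ 2 <= sqnorm x.
Proof.
by rewrite /sqnorm (bigD1 i)//= ler_wpDr// sumr_ge0// => j _; exact: sqr_ge0.
Qed.

Lemma sqnorm_eq0 x : (sqnorm x == 0) = (x == [tuple 0 | i < n]).
Proof.
apply/eqP/eqP => [x0|->].
  apply: eq_from_tnth => i; rewrite tnth_mktuple; apply/eqP.
  by rewrite -sqrf_eq0 eq_le sqr_ge0 -x0 sqr_tnth_le.
by rewrite /sqnorm big1// => i _; rewrite tnth_mktuple expr0n.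
Qed.

Lemma norm_tnth_le x i : `|tnth x i| <= 1 + sqnorm x.
Proof.
have := sqr_tnth_le x i; rewrite -[_ ^+ 2](real_normK (num_real _)).
have := normr_ge0 (tnth x i); move: (`|_|) => a; nra.
Qed.

Lemma norm_mul_tnth_le x i j : `|tnth x i * tnth x j| <= sqnorm x.
Proof.
have [->|ij] := eqVneq i j; first by rewrite -expr2 ger0_norm ?sqr_ge0 ?sqr_tnth_le.
have : tnth x i ^+ 2 + tnth x j ^+ 2 <= sqnorm x.
  rewrite /sqnorm (bigD1 i)//= (bigD1 j) 1?eq_sym//= addrA lerDl sumr_ge0// => k _.
  exact: sqr_ge0.
rewrite normrM -[tnth x i ^+ 2](real_normK (num_real _)) -[tnth x j ^+ 2](real_normK (num_real _)).
have := normr_ge0 (tnth x i); have := normr_ge0 (tnth x j).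
move: (`|tnth x i|) (`|tnth x j|) => a b; nra.
Qed.

Lemma norm_monom_le x al : `|monom x al| <= (1 + sqnorm x) ^+ mdeg al.
Proof.
rewrite /monom normr_prod mdegE -prodrXr /=; apply: ler_prod => i _.
by rewrite normr_ge0 normrX lerXn2r// ?nnegrE ?norm_tnth_le// addr_ge0// sqnorm_ge0.
Qed.

Lemma mdeg_gt0_split al : (0 < mdeg al)%N -> exists i ga, al = (U_(i) + ga)%MM.
Proof.
move=> al0; have [i ai] : exists i, al i != 0%N.
  apply/existsP; apply: contraLR al0 => /existsPn H; rewrite -eqn0Ngt mdeg_eq0.
  by apply/eqP/mnmP => i; rewrite mnm0E; have := H i; rewrite negbK => /eqP.
exists i, (al - U_(i))%MM; rewrite addmC submK//.
by apply/mnm_lepP => j; rewrite mnm1E; case: eqP => // <-; rewrite lt0n.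
Qed.

Lemma mdeg_gt1_split al : (1 < mdeg al)%N -> exists i j ga, al = (U_(i) + U_(j) + ga)%MM.
Proof.
move=> al1; have [i [ga E]] := mdeg_gt0_split (ltnW al1).
have : (0 < mdeg ga)%N by move: al1; rewrite E mdegD mdeg1.
by move=> /mdeg_gt0_split[j [de E2]]; exists i, j, de; rewrite E E2 addmA.
Qed.

Definition low_vanish (q : {mpoly R[n]}) := forall m : mindex n, (mdeg m < 2)%N -> q@_m = 0.

Lemma low_vanish_lin k p q : low_vanish p -> low_vanish q -> low_vanish (k *: p + q).
Proof. by move=> p0 q0 m m2; rewrite mcoeffD mcoeffZ p0// q0// mulr0 addr0. Qed.

Lemma low_vanishX al : (1 < mdeg al)%N -> low_vanish 'X_[al].
Proof.
move=> al1 m m2; rewrite mcoeffX; case: eqP => // E.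
by move: m2; rewrite -E ltnNge al1.
Qed.

Lemma low_vanish_mul p q : low_vanish p -> low_vanish (p * q).
Proof.
move=> p0 m m2; rewrite mcoeffM big1// => k /eqP E.
rewrite p0 ?mul0r//; apply: leq_ltn_trans m2; by apply: leq_trans (leq_addr (mdeg k.2) _) _; rewrite -mdegD -E.
Qed.

Definition sqnorm_poly : {mpoly R[n]} := \sum_i 'X_[U_(i) + U_(i)].

Lemma low_vanish_sqnorm : low_vanish sqnorm_poly.
Proof.
move=> m m2; rewrite /sqnorm_poly raddf_sum big1//= => i _.
by apply: low_vanishX => //; rewrite mdegD !mdeg1.
Qed.

Lemma meval_sqnorm x : meval (tnth x) sqnorm_poly = sqnorm x.
Proof.
by rewrite raddf_sum /=; apply: eq_bigr => i _; rewrite -monomE monomD !monomU.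
Qed.

End Monomials.

(** * The form on functions q / |x|^2 and its extension *)

Section QuadraticExtension.
Context {R : realType} {n : nat}.

Definition nonzero_tuple := {x : n.-tuple R | x != [tuple 0 | i < n]}.

Implicit Types (x : nonzero_tuple) (al : mindex n).

Definition monom_ratio al x : R := monom (val x) al / sqnorm (val x).

Lemma sqnorm_gt0 x : 0 < sqnorm (val x).
Proof. by rewrite lt_def sqnorm_ge0 andbT sqnorm_eq0; exact: valP x. Qed.

(** If q / |x|^2 is nonnegative off 0 then q is nonnegative everywhere, since it vanishes at 0; so
    the positivity of the form on polynomials is exactly that needed on ratios. *)
Lemma quadratic_extension (c : mindex n -> R) :
  (forall q, (forall v, 0 <= meval v q) -> meval (fun=> 0) q = 0 -> 0 <= coef_form c q) ->
  exists (V : set (nonzero_tuple -> R)) (L : (nonzero_tuple -> R) -> R),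
  [/\ forall k f g, V f -> V g -> V (fun x => k * f x + g x),
      forall f g, V g -> (forall x, `|f x| <= `|g x|) -> V f &
      V (cst 1)] /\
  [/\ forall k f g, V f -> V g -> L (fun x => k * f x + g x) = k * L f + L g,
      forall f, V f -> (forall x, 0 <= f x) -> 0 <= L f &
      forall al, (1 < mdeg al)%N -> [/\ V (monom_ratio al),
        V (fun x => sqnorm (val x) * monom_ratio al x) & L (monom_ratio al) = c al]].
Proof.
move=> cpos.
pose G0 : set ((nonzero_tuple -> R) * R) := [set fa | exists q : {mpoly R[n]}, low_vanish q /\
  fa = (fun x => meval (tnth (val x)) q / sqnorm (val x), coef_form c q)].
have linG : linear_graph G0.
  move=> k f g a b [p [p0 [-> ->]]] [q [q0 [-> ->]]].
  exists (k *: p + q); split; first exact: low_vanish_lin.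
  rewrite linearP; congr pair; apply/funext => x.
  by rewrite mevalD mevalZ mulrDl mulrA.
have posG : positive_graph G0.
  move=> f a [q [q0 [-> ->]]] fpos.
  have z0 : meval (fun=> 0) q = 0.
    rewrite mevalE big_seq big1// => m; rewrite mcoeff_msupp => qm.
    have [m2|m2] := ltnP (mdeg m) 2; first by rewrite q0 ?eqxx in qm *.
    have [i [ga ->]] := mdeg_gt0_split (ltnW m2).
    by rewrite (bigD1 i)//= mnmDE mnm1E eqxx add1n exprS mul0r mul0r mulr0.
  apply: cpos => // v.
  have E : meval v q = meval (tnth [tuple v i | i < n]) q.
    by apply: meval_eq => i; rewrite tnth_mktuple.
  have [v0|v0] := eqVneq [tuple v i | i < n] [tuple 0 | i < n].
    rewrite E v0 (_ : meval _ q = 0)//.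
    by rewrite -[RHS]z0; apply: meval_eq => i; rewrite tnth_mktuple.
  pose y : nonzero_tuple := exist (fun x : n.-tuple R => x != [tuple 0 | i < n]) _ v0.
  have := fpos y.
  by rewrite pmulr_lge0 ?invr_gt0 ?sqnorm_gt0// E.
have zeroG : G0 (cst 0, 0).
  exists 0; split; first by move=> m _; rewrite mcoeff0.
  by rewrite linear0; congr pair; apply/funext => x; rewrite meval0 mul0r.
have Vlin k f g : dominated G0 f -> dominated G0 g -> dominated G0 (fun x => k * f x + g x).
  move=> [f1 [a [Gf ff]]] [g1 [b [Gg gg]]].
  exists (fun x => `|k| * f1 x + g1 x), (`|k| * a + b); split; first exact: linG.
  move=> x; apply: le_trans (ler_normD _ _) _; rewrite normrM lerD//.
  by rewrite ler_wpM2l.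
have Vsolid f g : dominated G0 g -> (forall x, `|f x| <= `|g x|) -> dominated G0 f.
  by move=> [g1 [b [Gg gg]]] fg; exists g1, b; split=> // x; exact: le_trans (fg x) (gg x).
(* The numerator |x|^2 (1 + |x|^2)^k has no terms of degree below 2, so these powers belong to the
   graph themselves; k = 0 gives the constant 1. *)
have Vpow k : dominated G0 (fun x => (1 + sqnorm (val x)) ^+ k).
  exists (fun x => (1 + sqnorm (val x)) ^+ k), (coef_form c (sqnorm_poly * (1 + sqnorm_poly) ^+ k)).
  split; last by move=> x; rewrite ger0_norm// exprn_ge0// addr_ge0// sqnorm_ge0.
  exists (sqnorm_poly * (1 + sqnorm_poly) ^+ k); split.
    by apply: low_vanish_mul; exact: low_vanish_sqnorm.
  congr pair; apply/funext => x.
  rewrite mevalM rmorphXn /= mevalD meval1 meval_sqnorm mulrAC mulfV ?mul1r//.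
  by rewrite gt_eqF ?sqnorm_gt0.
have [L [Llin Lpos LG]] := riesz_extension linG posG zeroG.
exists (dominated G0), L; split; split=> //.
  by have := Vpow 0%N; congr dominated; apply/funext => x; rewrite expr0.
move=> al al1.
(* Two coordinate factors of the monomial are absorbed by the denominator, as |x_i x_j| <= |x|^2. *)
have bnd x : `|monom_ratio al x| <= (1 + sqnorm (val x)) ^+ mdeg al.
  have [i [j [ga ->]]] := mdeg_gt1_split al1.
  have s0 := sqnorm_gt0 x.
  rewrite /monom_ratio normrM normfV (ger0_norm (ltW s0)) ler_pdivrMr//.
  rewrite !monomD !monomU normrM mulrC mdegD addnC exprD.
  apply: ler_pM => //; rewrite ?normr_ge0//.
    apply: le_trans (norm_monom_le _ _) _.
    rewrite ler_peMr ?exprn_ge0 ?exprn_ege1//; lra.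
  exact: norm_mul_tnth_le.
split.
- apply: Vsolid (Vpow (mdeg al)) _ => x; apply: le_trans (bnd x) (ler_norm _).
- apply: Vsolid (Vpow (mdeg al).+1) _ => x; apply: le_trans (ler_norm _).
  have s0 := sqnorm_gt0 x.
  rewrite normrM exprS (ger0_norm (ltW s0)); apply: ler_pM => //; first exact: ltW.
  by rewrite lerDr.
- rewrite -[c al]coef_formX; apply: LG; exists 'X_[al]; split.
    exact: low_vanishX.
  by congr pair; apply/funext => x; rewrite /monom_ratio monomE.
Qed.

End QuadraticExtension.

(** * Sampling coordinates and ratios *)

Lemma regular_lincomb {R : realType} {X : choiceType} (x0 : X) (P : nat -> X -> bool) (T : X -> R)
    (J : Type) (r : seq J) (k : J -> R) (f : J -> X -> R) :
  (forall N : nat, word_continuous P (fun x => (T x < N%:R)%R%:R : R)) ->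
  (forall j, regular P T (f j)) -> regular P T (fun x => \sum_(j <- r) k j * f j x).
Proof.
move=> T_cont fr; elim: r => [|j r IH].
  rewrite (_ : (fun x => _) = cst 0); first exact: (regular_cst T_cont 0).
  by apply/funext => x; rewrite big_nil.
rewrite (_ : (fun x => _) = fun x => k j * f j x + \sum_(j <- r) k j * f j x).
  exact: regular_lin.
by apply/funext => x; rewrite big_cons.
Qed.

(** [Y i u] is the sampled coordinate and [Q al u] the sampled x^al / |x|^2, which keeps a meaning
    where all [Y i u] vanish. The last three clauses transport relations valid at nonzero points
    through the character at u. *)
Lemma quadratic_sampling {R : realType} {n : nat} (x0 : @nonzero_tuple R n) (c : mindex n -> R) :
  (forall q : {mpoly R[n]},
    (forall v, 0 <= meval v q) -> meval (fun=> 0) q = 0 -> 0 <= coef_form c q) ->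
  exists (M : R) (Y : 'I_n -> R -> R) (Q : mindex n -> R -> R),
  let I := `[0, M[%classic in let mu := @lebesgue_measure R in
  [/\ forall i, measurable_fun I (Y i),
      forall al, (1 < mdeg al)%N -> mu.-integrable I (EFin \o Q al) &
      forall al, (1 < mdeg al)%N -> (\int[mu]_(u in I) (Q al u)%:E = (c al)%:E)%E] /\
  [/\ forall al u, (1 < mdeg al)%N -> I u ->
        sqnorm [tuple Y i u | i < n] * Q al u = monom [tuple Y i u | i < n] al,
      forall al u, (2 < mdeg al)%N -> I u -> sqnorm [tuple Y i u | i < n] = 0 -> Q al u = 0 &
      forall (v : 'I_n -> R) u, I u ->
        0 <= \sum_(p : 'I_n * 'I_n) v p.1 * v p.2 * Q (U_(p.1) + U_(p.2))%MM u].
Proof.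
move=> /quadratic_extension[V [L [[V_lin V_solid V_one] [L_lin L_ge0 VL]]]].
pose X := @nonzero_tuple R n.
pose K : Type := option ('I_n + 'I_n * 'I_n).
pose ra i j : X -> R := monom_ratio (U_(i) + U_(j))%MM.
pose co i (x : X) := tnth (val x) i.
pose T (x : X) := sqnorm (val x).
(* T is itself among the questioned functions, so finite words decide T < N. There the coordinates
   are bounded by N + 1; the ratios are bounded by 1 everywhere. *)
pose g (k : option ('I_n + 'I_n * 'I_n)) : X -> R := match k with
  | None => T | Some (inl i) => co i | Some (inr p) => ra p.1 p.2 end.
pose P := threshold g.
have T_cont (N : nat) : word_continuous P (fun x => (T x < N%:R)%R%:R : R).
  exact: (threshold_continuous_nat g None N).
have T_ge0 x : 0 <= T x by exact: sqnorm_ge0.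
have [M [G [[G_lin G_mul G_ge0] [G_meas G_int G_L]]]] :=
  exists_sampling x0 V_lin V_solid V_one L_lin L_ge0 T_ge0 T_cont.
pose reg := regular P T.
have co_reg i : reg (co i).
  apply: (@regular_coordinate _ _ _ g (Some (inl i)) None) => N; exists N.+1 => x /= xN.
  by apply: le_trans (norm_tnth_le _ _) _; rewrite -natr1 addrC lerD2r ltW.
have raE i j x : ra i j x = co i x * co j x / T x.
  by rewrite /ra /monom_ratio monomD !monomU.
have ra_reg i j : reg (ra i j).
  apply: (@regular_coordinate _ _ _ g (Some (inr (i, j))) None) => N; exists 1%N => x /= _.
  rewrite raE normrM normfV (ger0_norm (T_ge0 x)) ler_pdivrMr ?sqnorm_gt0// mul1r.
  exact: norm_mul_tnth_le.
have cst_reg k : reg (cst k) by exact: regular_cst.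
have G0 u : `[0, M[%classic u -> G (cst 0) u = 0.
  move=> Iu; have := G_lin (-1) (cst 1) (cst 1) u (cst_reg 1) (cst_reg 1) Iu.
  rewrite mulN1r addNr => E; rewrite -[RHS]E; congr (G _ u).
  by apply/funext => x /=; rewrite mulr1 addNr.
have G_sum (J : Type) (r : seq J) (k : J -> R) (f : J -> X -> R) u :
    (forall j, reg (f j)) -> `[0, M[%classic u ->
    G (fun x => \sum_(j <- r) k j * f j x) u = \sum_(j <- r) k j * G (f j) u.
  move=> fr Iu; elim: r => [|j r IH].
    by rewrite big_nil -[RHS](G0 u Iu); congr (G _ u); apply/funext => x; rewrite big_nil.
  rewrite big_cons -IH -(G_lin _ _ _ _ (fr j) _ Iu); last exact: (regular_lincomb x0).
  by congr (G _ u); apply/funext => x; rewrite big_cons.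
pose y u : n.-tuple R := [tuple G (co i) u | i < n].
(* Every ratio of higher degree is a basic ratio x_i x_j / |x|^2 times coordinates; induction on the
   degree of the remaining monomial. *)
have Q_eq : forall i j ga, reg (monom_ratio (U_(i) + U_(j) + ga)%MM) /\ forall u, `[0, M[%classic u ->
    G (monom_ratio (U_(i) + U_(j) + ga)%MM) u = G (ra i j) u * monom (y u) ga.
  move=> i j ga; move: {2}(mdeg ga) (erefl (mdeg ga)) => d; elim: d ga => [|d IH] ga.
    move/eqP; rewrite mdeg_eq0 => /eqP ->; rewrite addm0; split; [exact: ra_reg|move=> u Iu].
    by rewrite [monom _ _]big1 ?mulr1// => k _; rewrite mnm0E expr0.
  move=> gad; have [k [de E]] : exists k de, ga = (U_(k) + de)%MM.
    by apply: mdeg_gt0_split; rewrite gad.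
  have [] := IH de; first by move: gad; rewrite E mdegD mdeg1 => -[].
  move=> r1 g1.
  have E1 : monom_ratio (U_(i) + U_(j) + ga)%MM =
      (fun x => co k x * monom_ratio (U_(i) + U_(j) + de)%MM x).
    by apply/funext => x; rewrite /monom_ratio E !monomD !monomU /co !mulrA; congr (_ / _); ring.
  split; first by rewrite E1; exact: (regular_mul x0 (co_reg k) r1).
  move=> u Iu; rewrite E1 (G_mul _ _ _ (co_reg k) r1 Iu) g1// E monomD monomU tnth_mktuple; ring.
have Q_reg al : (1 < mdeg al)%N -> reg (monom_ratio al).
  by move=> /mdeg_gt1_split[i [j [ga ->]]]; have [] := Q_eq i j ga.
have ra_y i j u : `[0, M[%classic u -> sqnorm (y u) * G (ra i j) u = G (co i) u * G (co j) u.
  move=> Iu; rewrite -(G_mul _ _ _ (co_reg i) (co_reg j) Iu).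
  (* Expanding |x|^2 into coordinates lets the character at u produce [sqnorm (y u)]; the factors 1
     fit the shape of [G_sum]. *)
  have -> : (fun x => co i x * co j x) = fun x => \sum_k 1 * ((co k x * co k x) * ra i j x).
    apply/funext => x; under eq_bigr do rewrite mul1r -expr2.
    rewrite -mulr_suml -/(sqnorm _) raE mulrCA divff ?mulr1//.
    by rewrite gt_eqF ?sqnorm_gt0.
  have cc k : reg (fun x => co k x * co k x) by exact: (regular_mul x0 (co_reg k) (co_reg k)).
  rewrite G_sum// => [|k]; last exact: (regular_mul x0 (cc k) (ra_reg i j)).
  rewrite /sqnorm mulr_suml; apply: eq_bigr => k _.
  by rewrite mul1r tnth_mktuple (G_mul _ _ _ (cc k) (ra_reg i j) Iu) (G_mul _ _ _ (co_reg k) (co_reg k) Iu) expr2.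
exists M, (fun i => G (co i)), (fun al => G (monom_ratio al)); split; split.
- by move=> i; apply: G_meas; exact: co_reg.
- by move=> al al1; have [V1 _ _] := VL _ al1; exact: (G_int _ (Q_reg _ al1) V1).
- by move=> al al1; have [V1 V2 <-] := VL _ al1; exact: (G_L _ (Q_reg _ al1) V1 V2).
- move=> al u /mdeg_gt1_split[i [j [ga ->]]] Iu; have [_ ->//] := Q_eq i j ga.
  by rewrite -/(y u) mulrA ra_y// !monomD !monomU !tnth_mktuple.
- move=> al u al2 Iu y0; have [i [j [ga E]]] := mdeg_gt1_split (ltnW al2).
  have [_ Qe] := Q_eq i j ga; rewrite E Qe//.
  have : (0 < mdeg ga)%N by move: al2; rewrite E !mdegD !mdeg1.
  move=> /mdeg_gt0_split[k [de ->]]; rewrite monomD monomU.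
  have /eqP := y0; rewrite sqnorm_eq0 -/(y u) => /eqP ->.
  by rewrite tnth_mktuple mul0r mulr0.
- move=> v u Iu; rewrite -(G_sum _ _ (fun p : 'I_n * 'I_n => v p.1 * v p.2) (fun p => ra p.1 p.2))//.
  apply: (G_ge0 _ _ _ Iu) => [|x].
    by apply: (regular_lincomb x0) => // p; exact: ra_reg.
  (* Before sampling, the matrix x_i x_j / |x|^2 has rank one, and its quadratic form is a square
     over |x|^2. *)
  rewrite [X in 0 <= X](_ : _ = (\sum_i v i * co i x) ^+ 2 / T x).
    by rewrite divr_ge0// sqr_ge0.
  rewrite expr2 mulr_suml mulr_suml -(pair_bigA _ (fun i j => v i * v j * ra i j x)) /=.
  apply: eq_bigr => i _; rewrite mulr_sumr mulr_suml; apply: eq_bigr => j _.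
  by rewrite raE; ring.
Qed.

Section TupleMeasurability.
Context {R : realType} {n : nat}.

Lemma measurable_monom (al : mindex n) : measurable_fun [set: n.-tuple R] (fun x => monom x al).
Proof.
apply: measurable_prod => i _; apply: measurable_funX; exact: measurable_tnth.
Qed.

Lemma measurable_sqnorm : measurable_fun [set: n.-tuple R] (@sqnorm R n).
Proof.
apply: measurable_sum => i; apply: measurable_funX; exact: measurable_tnth.
Qed.

Lemma enorm_ge1 (x : n.-tuple R) : (1 <= enorm x) = (1 <= sqnorm x).
Proof. by rewrite /enorm -[X in X <= _]sqrtr1 ler_psqrt// ?nnegrE ?ler01 ?sqnorm_ge0. Qed.

Lemma measurable_enorm_ge1 : measurable [set x : n.-tuple R | 1 <= enorm x].
Proof.
rewrite (_ : [set _ | _] = @sqnorm R n @^-1` `[1, +oo[).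
  by rewrite -[X in measurable X]setTI; apply: measurable_sqnorm.
by apply/seteqP; split=> x /=; rewrite in_itv /= andbT enorm_ge1.
Qed.

Lemma sqnormE (x : n.-tuple R) : sqnorm x = \sum_i monom x (U_(i) + U_(i))%MM.
Proof. by apply: eq_bigr => i _; rewrite monomD !monomU expr2. Qed.

Lemma norm_tnth_le_sqnorm (x : n.-tuple R) i : 1 <= sqnorm x -> `|tnth x i| <= sqnorm x.
Proof.
move=> x1; have := sqr_tnth_le x i; rewrite -[_ ^+ 2](real_normK (num_real _)).
have := normr_ge0 (tnth x i); move: (`|_|) => a; nra.
Qed.

End TupleMeasurability.

(** * The triplet (b, Sigma, nu) from the sampled functions *)

Section LevyMeasure.
Context {R : realType} {n : nat} (c : mindex n -> R).
Context (M : R) (Y : 'I_n -> R -> R) (Q : mindex n -> R -> R).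

Let I := `[0, M[%classic.
Let mu := @lebesgue_measure R.
Let y u : n.-tuple R := [tuple Y i u | i < n].

Hypothesis mY : forall i, measurable_fun I (Y i).
Hypothesis iQ : forall al, (1 < mdeg al)%N -> mu.-integrable I (EFin \o Q al).
Hypothesis intQ : forall al, (1 < mdeg al)%N -> (\int[mu]_(u in I) (Q al u)%:E = (c al)%:E)%E.
Hypothesis QE : forall al u, (1 < mdeg al)%N -> I u -> sqnorm (y u) * Q al u = monom (y u) al.
Hypothesis Q0 : forall al u, (2 < mdeg al)%N -> I u -> sqnorm (y u) = 0 -> Q al u = 0.
Hypothesis Q_psd : forall (v : 'I_n -> R) u, I u ->
  0 <= \sum_(p : 'I_n * 'I_n) v p.1 * v p.2 * Q (U_(p.1) + U_(p.2))%MM u.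

Let S u := sqnorm (y u).

Let mI : measurable I. Proof. exact: measurable_itv. Qed.

Let mS : measurable_fun I S.
Proof.
rewrite /S /sqnorm; under eq_fun do under eq_bigr do rewrite tnth_mktuple.
by apply: measurable_sum => i; apply: measurable_funX.
Qed.

Let D0 := I `&` S @^-1` [set 0].
Let D1 := I `&` S @^-1` (~` [set 0]).

Let mD0 : measurable D0. Proof. by apply: mS => //; exact: measurable_set1. Qed.
Let mD1 : measurable D1. Proof. by apply: mS => //; apply: measurableC; exact: measurable_set1. Qed.

(** Extension by 0 outside I makes the map measurable on the whole line, as the image measure
    requires. *)
Let phi u : n.-tuple R := [tuple (Y i \_ I) u | i < n].
(* As 0^-1 = 0, the weight vanishes where S does: that part of the mass goes into Sigma. *)
Let W : R -> R := (fun u => (S u)^-1) \_ I.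

Let phiE u : I u -> phi u = y u.
Proof. by move=> Iu; apply: eq_from_tnth => i; rewrite !tnth_mktuple patchE mem_set. Qed.

Let mphi : measurable_fun [set: R] phi.
Proof.
apply/measurable_fun_tnthP => i.
rewrite (_ : _ \o _ = Y i \_ I); first exact/(measurable_restrictT _ mI).
by apply/funext => u /=; rewrite tnth_mktuple.
Qed.

Let W_ge0 u : 0 <= W u.
Proof. by rewrite /W patchE; case: ifP => // _; rewrite invr_ge0 sqnorm_ge0. Qed.

Let mW : measurable_fun [set: R] W.
Proof.
apply/(measurable_restrictT _ mI).
(* For S >= 0, zero included, the inverse equals the real power of exponent -1, and powers are
   measurable. *)
have : measurable_fun I (fun u => S u `^ (-1)).
  exact: (measurableT_comp (measurable_powR _)).
by congr measurable_fun; apply/funext => u; rewrite powR_inv1// sqnorm_ge0.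
Qed.

Definition levy_measure := weighted_pushforward mu mW W_ge0 mphi.

Let monom_W u (al : mindex n) : (1 < mdeg al)%N -> monom (phi u) al * W u = (Q al \_ D1) u.
Proof.
move=> al1; rewrite /W !patchE; have [Iu|Iu] := boolP (u \in I); last first.
  by rewrite mulr0 memNset//; move=> [Iu' _]; move: Iu; rewrite mem_set.
move: Iu; rewrite inE => Iu; rewrite phiE// -QE//.
have [S0|S0] := eqVneq (S u) 0.
  by rewrite S0 invr0 mulr0 memNset//; move=> [_]; rewrite /preimage /= S0.
by rewrite mem_set; [rewrite mulrAC divff ?mul1r|split=> //; exact/eqP].
Qed.

Let iQ1 (al : mindex n) : (1 < mdeg al)%N -> mu.-integrable D1 (EFin \o Q al).
Proof. by move=> al1; exact: (@integrableS _ _ _ mu I D1 _ mI mD1 (@subIsetl _ _ _) (iQ al1)). Qed.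

Let iQ0 (al : mindex n) : (1 < mdeg al)%N -> mu.-integrable D0 (EFin \o Q al).
Proof. by move=> al1; exact: (@integrableS _ _ _ mu I D0 _ mI mD0 (@subIsetl _ _ _) (iQ al1)). Qed.

Let integral_monom (al : mindex n) : (1 < mdeg al)%N ->
  (\int[levy_measure]_x (monom x al)%:E = \int[mu]_(u in D1) (Q al u)%:E)%E.
Proof.
move=> al1; rewrite integral_weighted; last exact: measurable_monom.
rewrite [RHS]integral_mkcond; apply: eq_integral => u _.
by rewrite monom_W// !patchE; case: ifP.
Qed.

Let integral_norm_monom (al : mindex n) : (1 < mdeg al)%N ->
  (\int[levy_measure]_x (`|monom x al|)%:E < +oo)%E.
Proof.
move=> al1; rewrite integral_weighted; last first.
  by apply: measurableT_comp => //; exact: measurable_monom.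
have -> : (\int[mu]_x (`|monom (phi x) al| * W x)%:E = \int[mu]_(u in D1) `|(Q al u)%:E|)%E.
  rewrite [RHS]integral_mkcond; apply: eq_integral => u _.
  rewrite -[W u](ger0_norm (W_ge0 u)) -normrM monom_W// !patchE.
  by case: ifP => //; rewrite normr0.
by have /integrableP[_] := iQ1 al1.
Qed.

Let integrable_monom (al : mindex n) : (1 < mdeg al)%N ->
  levy_measure.-integrable setT (fun x => (monom x al)%:E).
Proof.
move=> al1; apply/integrableP; split; first by apply/measurable_EFinP; exact: measurable_monom.
exact: integral_norm_monom.
Qed.

Let c_split (al : mindex n) : (1 < mdeg al)%N ->
  ((c al)%:E = \int[mu]_(u in D0) (Q al u)%:E + \int[levy_measure]_x (monom x al)%:E)%E.
Proof.
move=> al1; rewrite -intQ// integral_monom// -integral_setU//.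
- congr integral; rewrite /D0 /D1 -setIUr -preimage_setU setUv.
  by rewrite preimage_setT setIT.
- have := measurable_int _ (iQ al1); apply: measurable_funS => //.
  by move=> u [[]|[]].
- by apply/disj_setPS => u [[_ S0] [_ nS0]]; exact: (nS0 S0).
Qed.

Let levy0 : levy_measure [set [tuple (0 : R) | i < n]] = 0%E.
Proof.
rewrite /levy_measure /weighted_pushforward; apply: integral0_eq => u /= pu.
rewrite /W patchE; case: ifP => // /[!inE] Iu; congr EFin.
suff -> : S u = 0 by rewrite invr0.
by apply/eqP; rewrite sqnorm_eq0 -phiE// pu.
Qed.

Let levy_sigma_finite : sigma_finite [set: n.-tuple R] levy_measure.
Proof.
(* Where k |x|^2 >= 1 the weight is at most k on an interval of finite length; at the point 0 the
   weight is 0. *)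
pose F (k : nat) := (@sqnorm R n @^-1` [set 0]) `|`
  ((fun x => k%:R * @sqnorm R n x) @^-1` `[1, +oo[).
have mF k : measurable (F k).
  apply: measurableU.
    by rewrite -[X in measurable X]setTI; apply: measurable_sqnorm => //; exact: measurable_set1.
  have mk : measurable_fun setT (fun x => k%:R * @sqnorm R n x).
    by apply: measurable_funM; [exact: measurable_cst|exact: measurable_sqnorm].
  by rewrite -[X in measurable X]setTI; apply: mk.
exists F.
  apply/esym/seteqP; split=> // x _.
  have [x0|x0] := eqVneq (sqnorm x) 0; first by exists 0%N => //; left.
  have xp : 0 < sqnorm x by rewrite lt_def x0 sqnorm_ge0.
  exists (Num.bound (sqnorm x)^-1) => //; right.
  rewrite /= in_itv /= andbT -ler_pdivrMr// div1r.
  by apply/ltW/archi_boundP; rewrite invr_ge0 ltW.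
move=> k; split; first exact: mF.
rewrite /levy_measure /weighted_pushforward integral_mkcond.
apply: (@le_lt_trans _ _ (\int[mu]_(u in I) (k%:R)%:E)%E); last first.
  have muI : (mu I < +oo)%E.
    by rewrite /mu /I lebesgue_measure_itv /=; case: ifP => _; rewrite ?ltry// -EFinB ltry.
  by rewrite integral_cst//; apply: lte_mul_pinfty.
rewrite [leRHS]integral_mkcond; apply: ge0_le_integral => //.
- by move=> u _; rewrite patchE; case: ifP => // _; rewrite lee_fin.
- have mpF : measurable (phi @^-1` F k) by rewrite -[X in measurable X]setTI; exact: (mphi measurableT (mF k)).
  apply/(measurable_restrictT _ mpF).
  by apply: measurable_funTS; exact/measurable_EFinP.
- by apply/(measurable_restrictT _ mI); exact: measurable_cst.
- move=> u _; rewrite !patchE; case: ifP => [/[!inE] /= Fu|_]; last first.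
    by case: ifP => // _; rewrite lee_fin.
  rewrite /W patchE; case: ifP => // /[!inE] Iu; rewrite lee_fin.
  case: Fu => /=; rewrite phiE// -/(S u); first by move=> ->; rewrite invr0.
  rewrite in_itv /= andbT => kS.
  have S0 : 0 < S u.
    rewrite lt_def sqnorm_ge0 andbT; apply/eqP => S0; move: kS; rewrite S0 mulr0; lra.
  by rewrite -[leLHS]mul1r ler_pdivrMr.
Qed.

(** [Sigma] integrates the ratios over [D0], so it inherits positivity from the pointwise matrices.
    The drift b is defined by its own equation; what remains for it is the integrability of x_i over
    |x| >= 1, where |x_i| <= |x|^2. *)
Lemma levy_representation : exists (b : 'I_n -> R) (Sigma : 'M[R]_n)
    (nu : {measure set (n.-tuple R) -> \bar R}),
  [/\ Sigma^T = Sigma,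
      (forall v : 'rV[R]_n, 0 <= (v *m Sigma *m v^T) 0 0),
      sigma_finite [set: n.-tuple R] nu &
      nu [set [tuple (0 : R) | i < n]] = 0%E] /\
  [/\
      (forall al : mindex n, (2 <= mpoly.mdeg al)%N ->
         (\int[nu]_x (`|monom x al|%R)%:E < +oo)%E) ,
      (forall i : 'I_n, (c (e_ i))%:E =
         ((b i)%:E + \int[nu]_(x in [set x : n.-tuple R | (1 <= enorm x)%R]) (tnth x i)%:E)%E),
      (forall i j : 'I_n, (c (e2_ i j))%:E =
         ((Sigma i j)%:E + \int[nu]_x (monom x (e2_ i j))%:E)%E) &
      (forall al : mindex n, (3 <= mpoly.mdeg al)%N ->
         ((c al)%:E = \int[nu]_x (monom x al)%:E)%E)].
Proof.
pose Sig (p : 'I_n * 'I_n) : R := fine (\int[mu]_(u in D0) (Q (U_(p.1) + U_(p.2))%MM u)%:E)%E.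
have U2 (p : 'I_n * 'I_n) : (1 < mdeg (U_(p.1) + U_(p.2))%MM)%N by rewrite mdegD !mdeg1.
have SigE p : (Sig p)%:E = (\int[mu]_(u in D0) (Q (U_(p.1) + U_(p.2))%MM u)%:E)%E.
  by rewrite /Sig fineK//; apply: integrable_fin_num => //; exact: iQ0.
pose B := [set x : n.-tuple R | (1 <= enorm x)%R].
have iB i : levy_measure.-integrable B (fun x => (tnth x i)%:E).
  have isq : levy_measure.-integrable B (fun x => (sqnorm x)%:E).
    apply: (integrableS measurableT) => //; first exact: measurable_enorm_ge1.
    under eq_fun do rewrite sqnormE -sumEFin.
    by apply: integrable_sum => // j _; apply: integrable_monom; rewrite mdegD !mdeg1.
  apply: le_integrable isq; first exact: measurable_enorm_ge1.
    by apply: measurable_funTS; apply/measurable_EFinP; exact: measurable_tnth.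
  move=> x; rewrite /B /= enorm_ge1 => x1; rewrite lee_fin.
  by rewrite (ger0_norm (sqnorm_ge0 _)) norm_tnth_le_sqnorm.
exists (fun i => c (e_ i) - fine (\int[levy_measure]_(x in B) (tnth x i)%:E)%E),
  (\matrix_(i, j) Sig (i, j)), levy_measure; split; split.
- by apply/matrixP => i j; rewrite !mxE /Sig /= addmC.
- move=> v; have -> : (v *m (\matrix_(i, j) Sig (i, j)) *m v^T) 0 0 =
      \sum_(p : 'I_n * 'I_n) v 0 p.1 * v 0 p.2 * Sig p.
    rewrite mxE -(pair_bigA _ (fun i j => v 0 i * v 0 j * Sig (i, j))) exchange_big /=.
    apply: eq_bigr => j _; rewrite !mxE mulr_suml; apply: eq_bigr => i _.
    by rewrite !mxE; ring.
  rewrite -lee_fin -sumEFin.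
  under eq_bigr do rewrite EFinM SigE -integralZl ?iQ0//.
  rewrite -integral_sum//; last by move=> p; apply: integrableZl => //; exact: iQ0.
  apply: integral_ge0 => u [Iu _].
  by under eq_bigr do rewrite -EFinM; rewrite sumEFin lee_fin Q_psd.
- exact: levy_sigma_finite.
- exact: levy0.
- by move=> al al2; exact: integral_norm_monom.
- move=> i; have fB := integrable_fin_num measurable_enorm_ge1 (iB i).
  by rewrite EFinB fineK// subeK.
- by move=> i j; rewrite mxE SigE; exact: (c_split (U2 (i, j))).
- move=> al al3; rewrite c_split; last exact: ltnW.
  rewrite [X in (X + _)%E](_ : _ = 0%E) ?add0e//; apply: integral0_eq => u [Iu Su].
  by rewrite Q0.
Qed.

End LevyMeasure.

(** * Positive semi-definite matrices as sums of squares *)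

Section SumOfSquares.
Context {R : realType} {n : nat}.
Implicit Types (S : 'I_n -> 'I_n -> R) (v : 'I_n -> R).

Definition quad_form S v : R := \sum_i \sum_j v i * v j * S i j.

(** Along the p-th axis the form is a quadratic polynomial in t; the elimination below extracts all
    its inequalities from this polynomial. *)
Lemma quad_form_shift S v p t : (forall i j, S i j = S j i) ->
  quad_form S (fun i => v i + t * (i == p)%:R) =
    quad_form S v + t *+ 2 * (\sum_i v i * S i p) + t ^+ 2 * S p p.
Proof.
move=> symS; rewrite /quad_form.
have E i : \sum_j (v i + t * (i == p)%:R) * (v j + t * (j == p)%:R) * S i j =
    \sum_j v i * v j * S i j + t * (v i * S i p) + (i == p)%:R * (t * \sum_j v j * S i j + t ^+ 2 * S i p).
  rewrite (eq_bigr (fun j => v i * v j * S i j + (j == p)%:R * (t * v i * S i j) +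
     (i == p)%:R * (t * (v j * S i j)) + (j == p)%:R * ((i == p)%:R * t ^+ 2 * S i j))); last first.
    by move=> j _; ring.
  have D F : \sum_j (j == p)%:R * F j = F p :> R.
    by rewrite (bigD1 p)//= eqxx mul1r big1 ?addr0// => j /negbTE ->; rewrite mul0r.
  by rewrite !big_split /= !D -mulr_sumr -mulr_sumr; ring.
under eq_bigr do rewrite E.
rewrite !big_split /= -mulr_sumr.
rewrite (bigD1 p (F := fun i => (i == p)%:R * _))//= eqxx mul1r.
rewrite [X in _ + (_ + X)]big1 ?addr0; last by move=> i /negbTE ->; rewrite mul0r.
rewrite [\sum_j v j * S p j](eq_bigr (fun i => v i * S i p)); last by move=> j _; rewrite symS.
ring.
Qed.

(* LDL decomposition: clear one row and column at a time. *)
Lemma psd_sum_squares_aux k S : (forall i j, S i j = S j i) ->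
  (forall v, 0 <= quad_form S v) -> (forall i j : 'I_n, (k <= i)%N -> S i j = 0) ->
  exists w : nat -> 'I_n -> R, forall i j, S i j = \sum_(l < k) w l i * w l j.
Proof.
elim: k S => [|k IH] S symS posS zS.
  by exists (fun _ _ => 0) => i j; rewrite big_ord0 zS.
(* One elimination step: subtracting u u^T must clear row k and keep positivity; u then becomes the
   k-th vector. *)
have step S' (u : 'I_n -> R) : (forall i j, S' i j = S i j - u i * u j) ->
    (forall v, 0 <= quad_form S' v) -> (forall i j : 'I_n, (k <= i)%N -> S' i j = 0) ->
    exists w : nat -> 'I_n -> R, forall i j, S i j = \sum_(l < k.+1) w l i * w l j.
  move=> S'E posS' zS'; have [|w wE] := IH S' _ posS' zS'.
    by move=> i j; rewrite !S'E symS; ring.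
  exists (fun l => if l == k then u else w l) => i j.
  rewrite big_ord_recr /= eqxx -[LHS](subrK (u i * u j)) -S'E wE; congr (_ + _).
  by apply: eq_bigr => l _; rewrite ltn_eqF.
have [nk|kn] := leqP n k.
  apply: (step S (fun=> 0)) => // [i j|i j ki]; first by rewrite mul0r subr0.
  by have := leq_trans (ltn_ord i) (leq_trans nk ki); rewrite ltnn.
pose p := Ordinal kn.
have qp v t : 0 <= quad_form S v + t *+ 2 * (\sum_i v i * S i p) + t ^+ 2 * S p p.
  by rewrite -quad_form_shift.
have quad0 : quad_form S (fun=> 0) = 0.
  by rewrite /quad_form big1// => i _; rewrite big1// => j _; rewrite !mul0r.
have a0 : 0 <= S p p.
  have := qp (fun=> 0) 1; rewrite quad0 expr1n mul1r add0r big1 ?mulr0 ?add0r//.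
  by move=> i _; rewrite mul0r.
have row (i : 'I_n) : (k <= i)%N -> i = p \/ (k < i)%N.
  rewrite leq_eqVlt => /predU1P[ki|]; [left; apply: ord_inj; exact: esym|by right].
(* With a zero pivot the polynomial in t is affine and bounded below, so its slope, an entry of
   column p, vanishes: otherwise t = - (y + 1) / (2 x) gives the value -1. *)
have [ap|ap] := eqVneq (S p p) 0.
  have Sp j : S j p = 0.
    pose x := S j p; pose y := quad_form S (fun i => (i == j)%:R).
    have H t : 0 <= y + t *+ 2 * x.
      have := qp (fun i => (i == j)%:R) t; rewrite ap mulr0 addr0.
      rewrite (bigD1 j)//= eqxx mul1r big1 ?addr0// => i /negbTE ->.
      by rewrite mul0r.
    apply/eqP; apply: contraT => x0.
    have := H (- (y + 1) / (2 * x)).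
    rewrite (_ : _ *+ 2 * x = - (y + 1)); last by field.
    lra.
  apply: (step S (fun=> 0)) => // [i j|i j /row[->|ki]]; first by rewrite mul0r subr0.
    by rewrite symS.
  by rewrite zS.
have {}a0 : 0 < S p p by rewrite lt_def ap.
pose r := Num.sqrt (S p p); have rr : r * r = S p p by rewrite -expr2 sqr_sqrtr// ltW.
have r0 : r != 0 by apply: contra_neq ap => r0; rewrite -rr r0 mul0r.
apply: (step (fun i j => S i j - S i p / r * (S j p / r)) (fun i => S i p / r)) => //.
- move=> v; pose b := \sum_i v i * S i p.
  have -> : quad_form (fun i j => S i j - S i p / r * (S j p / r)) v = quad_form S v - b ^+ 2 / S p p.
    have -> : b ^+ 2 / S p p = \sum_i \sum_j v i * v j * (S i p / r * (S j p / r)).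
      rewrite expr2 -rr mulr_suml mulr_suml; apply: eq_bigr => i _.
      by rewrite mulr_sumr mulr_suml; apply: eq_bigr => j _; field.
    rewrite /quad_form -sumrB; apply: eq_bigr => i _; rewrite -sumrB.
    by apply: eq_bigr => j _; ring.
  (* This t minimises the polynomial, and the minimum is the Schur complement evaluated at v. *)
  have := qp v (- b / S p p); rewrite -/b.
  suff -> : quad_form S v + (- b / S p p) *+ 2 * b + (- b / S p p) ^+ 2 * S p p =
    quad_form S v - b ^+ 2 / S p p by [].
  by field.
- move=> i j /row[->|ki]; last by rewrite (zS i j)// (zS i p)// !mul0r subrr.
  by rewrite (symS p j) -rr; field.
Qed.

Lemma psd_sum_squares (Sigma : 'M[R]_n) : Sigma^T = Sigma ->
  (forall v : 'rV[R]_n, 0 <= (v *m Sigma *m v^T) 0 0) ->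
  exists w : 'I_n -> n.-tuple R, forall i j, Sigma i j = \sum_l tnth (w l) i * tnth (w l) j.
Proof.
move=> symS posS; have [||i j ni|w wE] := @psd_sum_squares_aux n (fun i j => Sigma i j).
- by move=> i j; rewrite -[in LHS]symS mxE.
- move=> v; have := posS (\row_i v i); congr (0 <= _).
  rewrite mxE /quad_form exchange_big /=; apply: eq_bigr => j _.
  rewrite !mxE mulr_suml; apply: eq_bigr => i _; rewrite !mxE; ring.
- by have := leq_trans (ltn_ord i) ni; rewrite ltnn.
exists (fun l => [tuple w l i | i < n]) => i j; rewrite wE.
by apply: eq_bigr => l _; rewrite !tnth_mktuple.
Qed.

End SumOfSquares.

Lemma cvg_seq_sum (R : realType) (J : Type) (r : seq J) (F : nat -> J -> R) (l : J -> R) :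
  (forall j, F k j @[k --> \oo] --> l j) ->
  \sum_(j <- r) F k j @[k --> \oo] --> \sum_(j <- r) l j.
Proof.
move=> Fl; elim: r => [|j r IH].
  rewrite big_nil (_ : (fun k => _) = cst 0); first exact: cvg_cst.
  by apply/funext => k; rewrite big_nil.
rewrite big_cons (_ : (fun k => _) = fun k => F k j + \sum_(j <- r) F k j).
  exact: cvgD.
by apply/funext => k; rewrite big_cons.
Qed.

(** * The closed convex cone of generators *)

Section GeneratorCone.
Context {R : realType} {n : nat}.
Implicit Types (s c : mindex n -> R) (p q : {mpoly R[n]}) (al m : mindex n) (v : 'I_n -> R).

Definition diagonal_op s p : {mpoly R[n]} := \sum_(m <- msupp p) (p@_m * s m) *: 'X_[m].

Definition pos_seq s := pos_preserver (diagonal_op s).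

(* Condition (i): etA c t is convertible to the diagonal operator of m |-> expR (t * eigval c m). *)
Definition generator c := forall t, 0 <= t -> pos_seq (fun m => expR (t * eigval c m)).

Lemma mcoeff_diagonal s p m : (diagonal_op s p)@_m = p@_m * s m.
Proof.
rewrite /diagonal_op raddf_sum /=.
under eq_bigr do rewrite mcoeffZ mcoeffX.
have [mp|mp] := boolP (m \in msupp p).
  rewrite (bigD1_seq m) ?msupp_uniq//= eqxx mulr1 big1 ?addr0// => i /negbTE ->.
  by rewrite mulr0.
rewrite (memN_msupp_eq0 mp) mul0r big_seq big1// => i ip.
by case: eqP => [E|_]; [rewrite -E ip in mp|rewrite mulr0].
Qed.

Lemma diagonal_mul s r p : diagonal_op r (diagonal_op s p) = diagonal_op (fun m => s m * r m) p.
Proof. by apply/mpolyP => m; rewrite !mcoeff_diagonal mulrA. Qed.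

Lemma meval_diagonal s v p : meval v (diagonal_op s p) =
  \sum_(m <- msupp p) (p@_m * \prod_i v i ^+ m i) * s m.
Proof. by rewrite raddf_sum /=; apply: eq_bigr => m _; rewrite mevalZ mevalX mulrAC. Qed.

Lemma pos_seq_mul s r : pos_seq s -> pos_seq r -> pos_seq (fun m => s m * r m).
Proof. by move=> ps pr p p0 v; rewrite -diagonal_mul; apply: pr; exact: ps. Qed.

Lemma pos_seq_lin k s r : 0 <= k -> pos_seq s -> pos_seq r -> pos_seq (fun m => k * s m + r m).
Proof.
move=> k0 ps pr p p0 v; rewrite meval_diagonal.
rewrite (eq_bigr (fun m => k * ((p@_m * \prod_i v i ^+ m i) * s m) +
   (p@_m * \prod_i v i ^+ m i) * r m)); last by move=> m _; ring.
rewrite big_split /= -mulr_sumr -!meval_diagonal.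
by rewrite addr_ge0 ?mulr_ge0//; [exact: ps|exact: pr].
Qed.

Lemma pos_seq_cst k : 0 <= k -> pos_seq (fun=> k).
Proof.
move=> k0 p p0 v; rewrite meval_diagonal -mulr_suml mulr_ge0//.
by rewrite -mevalE.
Qed.

Lemma pos_seq_lim (s_ : nat -> mindex n -> R) s : (forall k, pos_seq (s_ k)) ->
  (forall m, s_ k m @[k --> \oo] --> s m) -> pos_seq s.
Proof.
move=> ps sl p p0 v.
have H : meval v (diagonal_op (s_ k) p) @[k --> \oo] --> meval v (diagonal_op s p).
  rewrite meval_diagonal (_ : (fun k => _) =
    fun k => \sum_(m <- msupp p) (p@_m * \prod_i v i ^+ m i) * s_ k m).
    by apply: cvg_seq_sum => m; apply: cvgMr; exact: sl.
  by apply/funext => k; rewrite meval_diagonal.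
rewrite -(cvg_lim _ H)//; apply: limr_ge; first by apply/cvg_ex; eexists; exact: H.
by apply: nearW => k; exact: ps.
Qed.

(** The exponential series: powers are compositions of the operator, and partial sums with positive
    coefficients and their limits preserve positivity. *)
Lemma pos_seq_expR s : pos_seq s -> pos_seq (fun m => expR (s m)).
Proof.
move=> ps; apply: (@pos_seq_lim (fun N m => series (exp_coeff (s m)) N)); last first.
  by move=> m; exact: is_cvg_series_exp_coeff.
have pX j : pos_seq (fun m => s m ^+ j).
  elim: j => [|j IH].
    have := pos_seq_cst ler01; congr pos_seq.
  have := pos_seq_mul ps IH; congr pos_seq.
  by apply/funext => m; rewrite exprS.
elim=> [|N IH].
  have := pos_seq_cst (lexx 0); congr pos_seq.
  by apply/funext => m; rewrite /series /= big_geq.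
have := @pos_seq_lin (N`!%:R^-1) _ _ _ (pX N) IH.
rewrite invr_ge0 ler0n => /(_ isT); congr pos_seq.
by apply/funext => m; rewrite /series /= big_nat_recr//= /exp_coeff addrC mulrC.
Qed.

Lemma eigvalE c al : eigval c al = coef_form c ('X_[al] \mPo shift_tuple 1).
Proof. by rewrite coef_form_shiftX. Qed.

Lemma coef_form_lin k c d q : coef_form (fun m => k * c m + d m) q = k * coef_form c q + coef_form d q.
Proof. by rewrite /coef_form mulr_sumr -big_split; apply: eq_bigr => m _ /=; ring. Qed.

Lemma eigval_lin k c d al : eigval (fun m => k * c m + d m) al = k * eigval c al + eigval d al.
Proof. by rewrite !eigvalE coef_form_lin. Qed.

(** Diagonal operators commute, so the semigroup of k A + B at time t is the product of that of A at
    time t k >= 0 and that of B at time t. *)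
Lemma generator_lin k c d : 0 <= k -> generator c -> generator d ->
  generator (fun m => k * c m + d m).
Proof.
move=> k0 gc gd t t0; have := pos_seq_mul (gc _ (mulr_ge0 t0 k0)) (gd _ t0).
congr pos_seq; apply/funext => m; rewrite -expRD eigval_lin; congr expR; ring.
Qed.

Lemma generator_lim (c_ : nat -> mindex n -> R) c : (forall k, generator (c_ k)) ->
  (forall m, c_ k m @[k --> \oo] --> c m) -> generator c.
Proof.
move=> gc cl t t0; apply: (@pos_seq_lim (fun k m => expR (t * eigval (c_ k) m))).
  by move=> k; exact: gc.
move=> m; apply: continuous_cvg; first exact: continuous_expR.
apply: cvgMr; rewrite eigvalE /coef_form (_ : (fun k => eigval (c_ k) m) =
  fun k => coef_form (c_ k) ('X_[m] \mPo shift_tuple 1)).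
  by apply: cvg_seq_sum => al; apply: cvgMr; exact: cl.
by apply/funext => k; rewrite eigvalE.
Qed.

(* With q(x) = p(v (1 + x)), the value at v of the image of p is the form applied to q. *)
Lemma generator_pos_form c : (forall q, (forall v, 0 <= meval v q) -> 0 <= coef_form c q) ->
  generator c.
Proof.
move=> cpos t t0; apply: pos_seq_expR.
have pc : pos_seq (eigval c).
  move=> p p0 v; pose d : mindex n -> R := fun m => \prod_i v i ^+ m i.
  have -> : meval v (diagonal_op (eigval c) p) = coef_form c (diagonal_op d p \mPo shift_tuple 1).
    rewrite meval_diagonal /diagonal_op (raddf_sum (comp_mpoly (shift_tuple 1))) (raddf_sum (coef_form c)) /=; apply: eq_bigr => m _.
    by rewrite comp_mpolyZ linearZ /= coef_form_shiftX.
  apply: cpos => x; rewrite comp_mpoly_meval meval_diagonal.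
  have := p0 (fun i => (tnth (shift_tuple 1) i).@[x] * v i); rewrite mevalE; congr (0 <= _).
  apply: eq_bigr => m _; rewrite -mulrA; congr (_ * _); rewrite /d mulrC -big_split /=.
  by apply: eq_bigr => i _; rewrite exprMn mulrC.
have := @pos_seq_lin t _ _ t0 pc (pos_seq_cst (lexx 0)); congr pos_seq.
by apply/funext => m; rewrite addr0.
Qed.

Lemma coef_form_monom (y : n.-tuple R) q : coef_form (monom y) q = meval (tnth y) q.
Proof. by []. Qed.

Lemma generator_monom (y : n.-tuple R) : generator (monom y).
Proof. by apply: generator_pos_form => q q0; rewrite coef_form_monom. Qed.

Definition zero_tuple : n.-tuple R := [tuple 0 | i < n].

Lemma monom_zero m : monom zero_tuple m = (mdeg m == 0%N)%:R.
Proof.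
rewrite /monom mdeg_eq0; have [->|m0] := eqVneq m 0%MM.
  by rewrite big1// => i _; rewrite mnm0E expr0.
have [|i [ga ->]] := @mdeg_gt0_split n m; first by rewrite lt0n mdeg_eq0.
by rewrite (bigD1 i)//= tnth_mktuple mnmDE mnm1E eqxx add1n expr0n mul0r.
Qed.

(** For the unit mass at 0 all eigenvalues are 1, so the semigroup is multiplication by exp(t k) >
    0, whatever the sign of k. *)
Lemma generator_zero k : generator (fun m => k * monom zero_tuple m).
Proof.
move=> t t0; have := pos_seq_cst (expR_ge0 (t * k)); congr pos_seq.
apply/funext => m; congr (expR (_ * _)).
have -> : eigval (fun m => k * monom zero_tuple m) m = k * eigval (monom zero_tuple) m.
  rewrite -[RHS]addr0 -[X in _ + X](_ : eigval (fun=> 0) m = 0) -?eigval_lin.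
    by congr eigval; apply/funext => x; rewrite addr0.
  by rewrite eigvalE /coef_form big1// => x _; rewrite mulr0.
rewrite eigvalE coef_form_monom comp_mpoly_meval mevalX big1 ?mulr1// => i _.
by rewrite !tnth_mktuple mevalD mevalXU mevalC tnth_mktuple add0r expr1n.
Qed.

Lemma generator_add c d : generator c -> generator d -> generator (fun m => c m + d m).
Proof.
move=> gc gd; have := generator_lin ler01 gc gd; congr generator.
by apply/funext => m; rewrite mul1r.
Qed.

Definition scale_tuple (k : R) (y : n.-tuple R) : n.-tuple R := [tuple k * tnth y i | i < n].

Lemma monom_scale k y m : monom (scale_tuple k y) m = k ^+ mdeg m * monom y m.
Proof.
rewrite /monom mdegE -prodrXr -big_split /=; apply: eq_bigr => i _.
by rewrite tnth_mktuple exprMn.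
Qed.

Let h (k : nat) : R := k.+1%:R^-1.

Let cvg_h_exp j : h k ^+ j @[k --> \oo] --> ((j == 0%N)%:R : R).
Proof.
have h0 : h k @[k --> \oo] --> (0 : R) by exact: cvg_harmonic.
elim: j => [|j IH]; first exact: cvg_cst.
rewrite (_ : (fun k => _) = fun k => h k * h k ^+ j); last first.
  by apply/funext => k; rewrite exprS.
by rewrite -[X in _ --> X](mul0r ((j == 0%N)%:R : R)); apply: cvgM.
Qed.

(** Difference quotient: the moments of (delta_{hy} - delta_0) / h are h^(j-1) y^m in degree j >= 1
    and 0 in degree 0, so only degree 1 survives as h tends to 0. *)
Lemma generator_drift y : generator (fun m => (mdeg m == 1%N)%:R * monom y m).
Proof.
pose c_ (k : nat) m := (h k)^-1 * monom (scale_tuple (h k) y) m + (- (h k)^-1) * monom zero_tuple m.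
have hk0 k : 0 <= (h k)^-1 by rewrite invrK.
apply: (@generator_lim c_).
  by move=> k; apply: generator_lin => //; [exact: generator_monom|exact: generator_zero].
move=> m; rewrite /c_; have hn k : h k != 0 by rewrite invr_eq0 pnatr_eq0.
case E : (mdeg m) => [|j].
  rewrite [X in _ --> X]mul0r; apply: cvg_near_cst; apply: nearW => k.
  move/eqP: E; rewrite mdeg_eq0 => /eqP ->.
  by rewrite monom_scale mdeg0 expr0 mul1r /monom !big1 ?mulr1 ?subrr// => i _; rewrite mnm0E expr0.
rewrite (_ : (fun k => _) = fun k => h k ^+ j * monom y m).
  by rewrite eqSS; apply: cvgMl; exact: cvg_h_exp.
apply/funext => k; rewrite monom_zero E mulr0 addr0 monom_scale E exprS.
by rewrite mulrA mulKf.
Qed.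

(** The moments of (delta_{hy} - delta_0) / h^2 are h^(j-2) y^m in degree j >= 1. The divergent
    degree 1 is cancelled by the drift - y / h, available since drifts have no sign restriction. *)
Lemma generator_square y : generator (fun m => (mdeg m == 2)%N%:R * monom y m).
Proof.
pose c_ (k : nat) m := (h k)^-1 ^+ 2 * monom (scale_tuple (h k) y) m +
  ((- (h k)^-1 ^+ 2) * monom zero_tuple m +
   (mdeg m == 1%N)%:R * monom (scale_tuple (- (h k)^-1) y) m).
have hk0 k : 0 <= (h k)^-1 ^+ 2 by rewrite exprn_ge0// invrK.
apply: (@generator_lim c_).
  move=> k; apply: generator_lin => //; first exact: generator_monom.
  by apply: generator_add; [exact: generator_zero|exact: generator_drift].
move=> m; rewrite /c_; have hn k : h k != 0 by rewrite invr_eq0 pnatr_eq0.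
case E : (mdeg m) => [|[|j]].
- rewrite [X in _ --> X]mul0r; apply: cvg_near_cst; apply: nearW => k.
  move/eqP: E; rewrite mdeg_eq0 => /eqP ->.
  by rewrite monom_scale mdeg0 expr0 mul1r /monom !big1 ?mulr1 ?mul0r ?addr0 ?subrr// => i _; rewrite mnm0E expr0.
- rewrite [X in _ --> X]mul0r; apply: cvg_near_cst; apply: nearW => k.
  rewrite monom_zero E mulr0 add0r mul1r !monom_scale E !expr1.
  by field; exact: hn.
- rewrite (_ : (fun k => _) = fun k => h k ^+ j * monom y m).
    by rewrite !eqSS; apply: cvgMl; exact: cvg_h_exp.
  apply/funext => k; rewrite monom_zero E mulr0 mul0r !addr0 monom_scale E !exprS.
  by field; exact: hn.
Qed.

Lemma generator_sum (J : Type) (r : seq J) (F : J -> mindex n -> R) :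
  (forall j, generator (F j)) -> generator (fun m => \sum_(j <- r) F j m).
Proof.
move=> gF; elim: r => [|j r IH].
  have := generator_zero 0; congr generator.
  by apply/funext => m; rewrite big_nil mul0r.
have := generator_add (gF j) IH; congr generator.
by apply/funext => m; rewrite big_cons.
Qed.

End GeneratorCone.

(** * From the triplet to the semigroup *)

Section LevyGenerator.
Context {R : realType} {n : nat} (c : mindex n -> R) (Sigma : 'M[R]_n).
Context (nu : {measure set (n.-tuple R) -> \bar R}).
Hypothesis symSigma : Sigma^T = Sigma.
Hypothesis psdSigma : forall v : 'rV[R]_n, 0 <= (v *m Sigma *m v^T) 0 0.
Hypothesis nu_fin : forall al : mindex n, (2 <= mdeg al)%N ->
  (\int[nu]_x (`|monom x al|%R)%:E < +oo)%E.
Hypothesis c2 : forall i j : 'I_n, (c (e2_ i j))%:E =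
  ((Sigma i j)%:E + \int[nu]_x (monom x (e2_ i j))%:E)%E.
Hypothesis c3 : forall al : mindex n, (3 <= mdeg al)%N ->
  ((c al)%:E = \int[nu]_x (monom x al)%:E)%E.

Let integrable_monom (al : mindex n) : (2 <= mdeg al)%N ->
  nu.-integrable setT (fun x => (monom x al)%:E).
Proof.
move=> al2; apply/integrableP; split; first by apply/measurable_EFinP; exact: measurable_monom.
exact: nu_fin.
Qed.

Let integrable_sqnorm : nu.-integrable setT (fun x => (sqnorm x)%:E).
Proof.
under eq_fun do rewrite sqnormE -sumEFin.
by apply: integrable_sum => // j _; apply: integrable_monom; rewrite mdegD !mdeg1.
Qed.

Let B (k : nat) : set (n.-tuple R) := [set x | 1 <= k.+1%:R * sqnorm x].

Let mB k : measurable (B k).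
Proof.
have mk : measurable_fun setT (fun x : n.-tuple R => k.+1%:R * sqnorm x).
  by apply: measurable_funM; [exact: measurable_cst|exact: measurable_sqnorm].
rewrite (_ : B k = (fun x : n.-tuple R => k.+1%:R * sqnorm x) @^-1` `[1, +oo[).
  by rewrite -[X in measurable X]setTI; apply: mk.
by apply/seteqP; split=> x /=; rewrite in_itv /= andbT.
Qed.

(** Away from 0 the degrees 0 and 1 become integrable too: on [B k] they are at most 1 + |x|^2 <= (k
    + 2) |x|^2. *)
Let integrable_B k (al : mindex n) : nu.-integrable (B k) (fun x => (monom x al)%:E).
Proof.
have [al2|al2] := leqP 2 (mdeg al).
  exact: (@integrableS _ _ _ nu setT (B k) _ measurableT (mB k) (@subsetT _ _) (integrable_monom al2)).
have isq : nu.-integrable (B k) (fun x => (k.+2%:R)%:E * (sqnorm x)%:E)%E.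
  apply: integrableZl => //.
  exact: (@integrableS _ _ _ nu setT (B k) _ measurableT (mB k) (@subsetT _ _) integrable_sqnorm).
apply: le_integrable isq => //.
  by apply: measurable_funTS; apply/measurable_EFinP; exact: measurable_monom.
move=> x; rewrite /B /= => xk; rewrite lee_fin.
have s0 := sqnorm_ge0 x.
apply: le_trans (norm_monom_le _ _) _; rewrite ger0_norm ?mulr_ge0//.
have -> : k.+2%:R * sqnorm x = k.+1%:R * sqnorm x + sqnorm x by rewrite -natr1; ring.
have : (1 + sqnorm x) ^+ mdeg al <= 1 + sqnorm x.
  by case: (mdeg al) al2 => [|[|//]] _; rewrite ?expr0 ?expr1 ?lerDl.
lra.
Qed.

Let ck k (al : mindex n) : R := fine (\int[nu]_(x in B k) (monom x al)%:E)%E.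

Let ckE k al : (ck k al)%:E = (\int[nu]_(x in B k) (monom x al)%:E)%E.
Proof. by rewrite /ck fineK//; apply: integrable_fin_num => //; exact: mB. Qed.

Let generator_ck k : generator (ck k).
Proof.
apply: generator_pos_form => q q0; rewrite -lee_fin /coef_form -sumEFin.
under eq_bigr do rewrite EFinM ckE -(integralZl (mB k) (integrable_B k _)).
rewrite -(integral_sum (mB k)); last first.
  by move=> m; apply: integrableZl; [exact: mB|exact: integrable_B].
apply: integral_ge0 => x _.
under eq_bigr do rewrite -EFinM.
by rewrite sumEFin lee_fin; exact: q0.
Qed.

Let cvg_ck al : (2 <= mdeg al)%N ->
  ck k al @[k --> \oo] --> fine (\int[nu]_x (monom x al)%:E)%E.
Proof.
move=> al2; apply: fine_cvg; rewrite fineK; last first.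
  by apply: integrable_fin_num => //; exact: integrable_monom.
rewrite (_ : (fun k => _) = fun k =>
   \int[nu]_x ((fun x => (monom x al)%:E) \_ (B k)) x)%E; last first.
  by apply/funext => k; rewrite [LHS]integral_mkcond.
apply: (@dominated_cvg _ _ _ nu setT measurableT (fun k => (fun x => (monom x al)%:E) \_ (B k))
  (fun x => (monom x al)%:E) (fun x => `|(monom x al)%:E|%E)) => //.
- move=> k; apply/(measurable_restrictT _ (mB k)); apply: measurable_funTS.
  by apply/measurable_EFinP; exact: measurable_monom.
(* The origin belongs to no [B k], but monomials of degree at least 2 vanish there; any other x is
   in [B k] for all large k. *)
- move=> x _; have [x0|x0] := eqVneq (sqnorm x) 0.
    have mx0 : monom x al = 0.
      move/eqP: x0; rewrite sqnorm_eq0 => /eqP ->.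
      by rewrite [LHS]monom_zero; case: (mdeg al) al2.
    by apply: cvg_near_cst; apply: nearW => k; rewrite patchE mx0; case: ifP.
  have s0 : 0 < sqnorm x by rewrite lt_def x0 sqnorm_ge0.
  apply: cvg_near_cst; exists (Num.bound (sqnorm x)^-1) => // k /= kb.
  rewrite patchE mem_set// /B /= -ler_pdivrMr// div1r.
  apply: le_trans (ltW (archi_boundP _)) _; first by rewrite invr_ge0 ltW.
  by rewrite ler_nat (leq_trans kb).
- by apply: integrable_abse; exact: integrable_monom.
- by move=> k x _; rewrite patchE; case: ifP => // _; rewrite abse0.
Qed.

Lemma generator_levy : generator c.
Proof.
have [w wE] := psd_sum_squares symSigma psdSigma.
(* The moments of degree 0 and 1 over [B k] may diverge with k. A multiple of the unit mass at 0 and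
   the drift [r k] correct them to the values of c for every k, so a limit is taken only in degree
   at least 2. *)
pose r k : n.-tuple R := [tuple c (e_ i) - ck k (e_ i) | i < n].
pose d k m := ck k m + ((c 0%MM - ck k 0%MM) * monom zero_tuple m +
  ((mdeg m == 1%N)%:R * monom (r k) m + \sum_l (mdeg m == 2)%N%:R * monom (w l) m)).
apply: (@generator_lim _ _ d) => [k|m].
  apply: generator_add; first exact: generator_ck.
  apply: generator_add; first exact: generator_zero.
  apply: generator_add; first exact: generator_drift.
  by apply: generator_sum => l; exact: generator_square.
have sum0 : mdeg m != 2 -> \sum_l (mdeg m == 2)%N%:R * monom (w l) m = 0.
  by move=> /negbTE m2; rewrite big1// => l _; rewrite m2 mul0r.
rewrite /d; have [m2|m2] := leqP 2 (mdeg m); last first.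
  have m2' : mdeg m != 2 by rewrite ltn_eqF.
  apply: cvg_near_cst; apply: nearW => k /=; rewrite (sum0 m2') addr0 monom_zero.
  case E : (mdeg m) m2 => [|[|//]] _.
    move/eqP: E; rewrite mdeg_eq0 => /eqP -> /=; ring.
  move/eqP: E => /mdeg1P[i /eqP ->].
  by rewrite monomU tnth_mktuple /=; ring.
have mn0 : (mdeg m == 0%N) = false by case: (mdeg m) m2.
have mn1 : (mdeg m == 1%N) = false by case: (mdeg m) m2 => [|[]].
rewrite (_ : (fun k => _) = fun k => ck k m + \sum_l (mdeg m == 2)%N%:R * monom (w l) m); last first.
  by apply/funext => k; rewrite monom_zero mn0 mn1 mulr0 mul0r !add0r.
have -> : c m = fine (\int[nu]_x (monom x m)%:E)%E + \sum_l (mdeg m == 2)%N%:R * monom (w l) m.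
  have fm : (\int[nu]_x (monom x m)%:E)%E \is a fin_num.
    by apply: integrable_fin_num => //; exact: integrable_monom.
  apply: EFin_inj; rewrite EFinD fineK//.
  have [m3|m3] := leqP 3 (mdeg m).
    have m2' : mdeg m != 2 by rewrite gtn_eqF.
    by rewrite (sum0 m2') adde0 c3.
  have E : mdeg m = 2 by apply/eqP; rewrite eqn_leq m2 -ltnS m3.
  have [i [j [ga Em]]] := mdeg_gt1_split m2.
  have ga0 : ga = 0%MM.
    apply/eqP; rewrite -mdeg_eq0; move: E; rewrite Em !mdegD !mdeg1.
    by move=> /eqP; rewrite -[X in _ == X]addn0 eqn_add2l.
  have {}Em : m = e2_ i j by rewrite Em ga0 addm0.
  rewrite E Em c2 addeC; congr (_ + _)%E; congr EFin; rewrite wE.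
  by apply: eq_bigr => l _; rewrite mul1r /e2_ monomD !monomU.
by apply: cvgD; [exact: cvg_ck|exact: cvg_cst].
Qed.

End LevyGenerator.

Unset Implicit Arguments.
Set Strict Implicit.

Theorem mainTheorem8 (R : realType) (n : nat) (c : mindex n -> R) :
  (forall t : R, 0 <= t -> pos_preserver (etA c t))
  <->
  (exists (b : 'I_n -> R) (Sigma : 'M[R]_n)
          (nu : {measure set (n.-tuple R) -> \bar R}),
     [/\ Sigma^T = Sigma,
         (forall v : 'rV[R]_n, 0 <= (v *m Sigma *m v^T) 0 0),
         sigma_finite [set: n.-tuple R] nu &
         nu [set [tuple (0 : R) | i < n]] = 0%E] /\
     [/\
         (forall al : mindex n, (2 <= mpoly.mdeg al)%N ->
            (\int[nu]_x (`|monom x al|%R)%:E < +oo)%E) ,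
         (forall i : 'I_n, (c (e_ i))%:E =
            ((b i)%:E + \int[nu]_(x in [set x : n.-tuple R | (1 <= enorm x)%R]) (tnth x i)%:E)%E),
         (forall i j : 'I_n, (c (e2_ i j))%:E =
            ((Sigma i j)%:E + \int[nu]_x (monom x (e2_ i j))%:E)%E) &
         (forall al : mindex n, (3 <= mpoly.mdeg al)%N ->
            ((c al)%:E = \int[nu]_x (monom x al)%:E)%E)]).
Proof.
split=> [cpos|[b [Sigma [nu [[symS psdS _ _] [fin _ c2 c3]]]]]]; last exact: generator_levy c2 c3.
(* R^0 has no nonzero point to serve as the default sample; there every condition on c is vacuous
   and the zero measure works. *)
have [n0|n0] := posnP n.
  subst n.
  have mdeg_lt (al : mindex 0) k : (k < mdeg al)%N -> False by rewrite mdegE big_ord0.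
  exists (fun=> 0), 0, mzero; split; split.
  - by rewrite trmx0.
  - by move=> v; rewrite mulmx0 mul0mx mxE.
  - exact: sigma_finite_mzero.
  - by [].
  - by move=> al /mdeg_lt.
  - by case.
  - by case.
  - by move=> al /mdeg_lt.
have one_neq0 : [tuple (1 : R) | i < n] != [tuple 0 | i < n].
  apply/eqP => /(congr1 (fun x => tnth x (Ordinal n0))).
  by rewrite !tnth_mktuple; apply/eqP; exact: oner_neq0.
pose x0 : nonzero_tuple := exist (fun x : n.-tuple R => x != [tuple 0 | i < n]) _ one_neq0.
have [M [Y [Q [[mY iQ intQ] [QE Q0 Qpsd]]]]] :=
  quadratic_sampling x0 (fun q => coef_form_ge0 (q := q) cpos).
exact: (levy_representation mY iQ intQ QE Q0 Qpsd).
Qed.
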